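(* Let $N \ge 1$ and let $\mu = \mathcal{N}(a, A)$ and $\nu = \mathcal{N}(b, B)$ be non-degenerate Gaussian distributions on $\mathbb{R}^N$ (so $a,b\in\mathbb{R}^N$ and $A,B$ are symmetric positive definite). Let $A = LL^{\top}$ and $B = MM^{\top}$ be the Cholesky decompositions of $A$ and $B$, where $L, M$ are lower triangular with positive diagonal entries. Then the adapted $2$-Wasserstein distance $\mathcal{AW}_2(\mu, \nu)$ is given by $$\mathcal{AW}_2^2(\mu, \nu) = \|a - b\|^2 + d_{\mathrm{ABW}}^2(A, B),$$ where $$d_{\mathrm{ABW}}^2(A, B) := \operatorname{tr}(A) + \operatorname{tr}(B) - 2 \|\operatorname{diag}(L^{\top}M)\|_1 .$$
   Context: Here $\operatorname{diag}(\cdot)\in\mathbb{R}^N$ is the vector of diagonal entries of a square matrix, $\|\cdot\|_1$ is the $\ell_1$-norm, and $\|\cdot\|$ is the Euclidean norm. For Borel probability measures $\mu,\nu$ on $\mathbb{R}^N$, $\Pi(\mu,\nu)$ is the set of couplings, i.e. Borel probability measures $\pi$ on $\mathbb{R}^N\times\mathbb{R}^N$ with first marginal $\mu$ and second marginal $\nu$. Let $(X,Y)=((X_t)_{t=1}^N,(Y_t)_{t=1}^N)\sim\pi$ and write $X_{1:t}=(X_1,\dots,X_t)$. A coupling $\pi$ is causal in the direction $\mu$ to $\nu$ if for all $t\in\{1,\dots,N\}$ and Borel $E\subset\mathbb{R}^t$, $\mathbb{P}_\pi(Y_{1:t}\in E\mid X_{1:N})=\mathbb{P}_\pi(Y_{1:t}\in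 E\mid X_{1:t})$ almost surely. It is bicausal if it is causal in both directions (the same condition also holds with the roles of $X$ and $Y$ exchanged); $\Pi_{bc}(\mu,\nu)$ is the set of bicausal couplings. For $\mu,\nu$ with finite second moments, the adapted ($2$-)Wasserstein distance is defined by $$\mathcal{AW}_2^2(\mu,\nu)=\inf_{\pi\in\Pi_{bc}(\mu,\nu)}\int_{\mathbb{R}^N\times\mathbb{R}^N}\|x-y\|^2\,\pi(\mathrm{d}x\,\mathrm{d}y).$$ *)

(* Defs.v *)
From HB Require Import structures.
From mathcomp Require Import all_boot all_order all_algebra.
From mathcomp Require Import all_classical all_reals all_analysis.
From mathcomp Require Import measurable_realfun.

Set Implicit Arguments.
Unset Strict Implicit.
Unset Printing Implicit Defensive.

Import Order.TTheory GRing.Theory Num.Theory.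
Import numFieldNormedType.Exports.

Local Open Scope classical_set_scope.
Local Open Scope ring_scope.

(* As a measurable space, R^N is the space of N-tuples with the product of the
   Borel sigma-algebras of R, which is the Borel sigma-algebra of R^N. *)
Notation euclid R N := (N.-tuple (measurableTypeR R)).

Section linear_algebra.
Context (R : realType).

Definition vec N (x : euclid R N) : 'cV[R]_N := \col_i tnth x i.

(* The library norm `|v| of a matrix is the sup norm, hence the explicit
   Euclidean and l1 norms. *)
Definition enorm N (v : 'cV[R]_N) : R := Num.sqrt (\sum_i v i ord0 ^+ 2).

Definition l1norm N (v : 'cV[R]_N) : R := \sum_i `|v i ord0|.

Definition diag_vec N (A : 'M[R]_N) : 'cV[R]_N := \col_i A i i.

Definition sym_posdef N (A : 'M[R]_N) : Prop :=
  A^T = A /\ forall v : 'cV[R]_N, v != 0 -> 0 < (v^T *m A *m v) ord0 ord0.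

Definition is_cholesky N (A L : 'M[R]_N) : Prop :=
  [/\ is_trig_mx L, forall i, 0 < L i i & A = L *m L^T].

(* L and M stand for the Cholesky factors of A and B. *)
Definition dABW_sq N (A B L M : 'M[R]_N) : R :=
  \tr A + \tr B - 2 * l1norm (diag_vec (L^T *m M)).

End linear_algebra.

Section lebesgue.
Context (R : realType).

Definition tcons n (p : measurableTypeR R * euclid R n) : euclid R n.+1 :=
  [tuple of p.1 :: p.2].

Definition tuncons n (x : euclid R n.+1) : measurableTypeR R * euclid R n :=
  (thead x, [tuple of behead x]).

Lemma measurable_tcons n : measurable_fun setT (@tcons n).
Proof. exact: measurable_cons. Qed.

Lemma measurable_tuncons n : measurable_fun setT (@tuncons n).
Proof.
apply/measurable_fun_pairP; split; last exact: measurable_behead.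
exact: measurable_tnth.
Qed.

Section cons_measure.
Context n (m : {sigma_finite_measure set (euclid R n) -> \bar R}).

Definition cons_measure : set (euclid R n.+1) -> \bar R :=
  pushforward (@lebesgue_measure R \x m)%E (@tcons n).

Let cons_measure0 : cons_measure set0 = 0%E.
Proof. by apply: measure0; exact: measurable_tcons. Qed.

Let cons_measure_ge0 A : (0 <= cons_measure A)%E.
Proof. by apply: measure_ge0; exact: measurable_tcons. Qed.

Let cons_measure_sigma_additive : semi_sigma_additive cons_measure.
Proof. by apply: measure_semi_sigma_additive; exact: measurable_tcons. Qed.

HB.instance Definition _ := isMeasure.Build _ _ _ cons_measure
  cons_measure0 cons_measure_ge0 cons_measure_sigma_additive.

Let cons_measure_sigma_finite : sigma_finite setT cons_measure.
Proof.
have /sigma_finiteP[F [FT ndF Foo]] := sigma_finiteT (@lebesgue_measure R).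
have /sigma_finiteP[G [GT ndG Goo]] := sigma_finiteT m.
exists (fun k => @tuncons n @^-1` (F k `*` G k)).
  rewrite -preimage_bigcup (_ : \bigcup_k _ = setT) ?preimage_setT//.
  apply/seteqP; split => // -[x t] _.
  have : setT x by []. have : setT t by [].
  rewrite FT GT => -[i _ Git] [j _ Fjx]; exists (maxn i j) => //; split => /=.
    by move: Fjx; exact/subsetPset/ndF/leq_maxr.
  by move: Git; exact/subsetPset/ndG/leq_maxl.
move=> k; have [mF Fkoo] := Foo k; have [mG Gkoo] := Goo k; split.
  rewrite -[X in measurable X]setTI; apply: measurable_tuncons => //.
  exact: measurableX.
rewrite /cons_measure /pushforward -comp_preimage.
rewrite (_ : _ \o _ = id) ?preimage_id; last first.
  by apply/funext => -[x t] /=; congr pair; apply/val_inj.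
by rewrite product_measure1E// lte_mul_pinfty// ge0_fin_numE.
Qed.

HB.instance Definition _ :=
  @Measure_isSigmaFinite.Build _ _ _ cons_measure cons_measure_sigma_finite.

End cons_measure.

(* Lebesgue measure on R^n, by R^(n+1) = R * R^n; R^0 is a point of mass 1. *)
Fixpoint lebesgue_tuple n : {sigma_finite_measure set (euclid R n) -> \bar R} :=
  if n is n'.+1 then cons_measure (lebesgue_tuple n')
  else \d_([tuple] : euclid R 0).

End lebesgue.

Section gaussian.
Context (R : realType) (N : nat).

Definition gaussian_pdf (a : 'cV[R]_N) (A : 'M[R]_N) (x : 'cV[R]_N) : R :=
  (Num.sqrt ((2 * pi) ^+ N * \det A))^-1 *
  expR (- ((x - a)^T *m invmx A *m (x - a)) ord0 ord0 / 2).

(* mu = N(a, A), for A symmetric positive definite. *)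
Definition is_gaussian (mu : probability (euclid R N) R) (a : 'cV[R]_N)
    (A : 'M[R]_N) : Prop :=
  forall E, measurable E ->
    mu E = (\int[lebesgue_tuple R N]_(x in E) (gaussian_pdf a A (vec x))%:E)%E.

End gaussian.

Section conditional_probability.
Context d (T : measurableType d) (R : realType) (P : probability T R).

(* g is a version of the conditional probability P(A | G), for a
   sub-sigma-algebra G; any two versions agree P-almost surely. *)
Definition is_cond_prob (G : set (set T)) (A : set T) (g : T -> \bar R) :
    Prop :=
  [/\ P.-integrable setT g,
      forall U : set (\bar R), measurable U -> G (g @^-1` U) &
      forall B, G B -> (\int[P]_(w in B) g w)%E = P (A `&` B)].

End conditional_probability.

Section adapted_wasserstein.
Context (R : realType) (N : nat).

Definition tprefix t (tN : (t <= N)%N) (x : euclid R N) : euclid R t :=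
  [tuple tnth x (widen_ord tN i) | i < t].

(* The two conditional probabilities of the definition of causality are
   almost surely unique, so it does not matter which versions are compared. *)
Definition causal d (T : measurableType d) (P : probability T R)
    (X Y : T -> euclid R N) : Prop :=
  forall t (tN : (t <= N)%N), (0 < t)%N ->
  forall E : set (euclid R t), measurable E ->
  exists g h : T -> \bar R,
    [/\ is_cond_prob P (g_sigma_algebra_preimage X)
          ((tprefix tN \o Y) @^-1` E) g,
        is_cond_prob P (g_sigma_algebra_preimage (tprefix tN \o X))
          ((tprefix tN \o Y) @^-1` E) h &
        {ae P, forall w, g w = h w}].

Definition coupling (mu nu : probability (euclid R N) R) :
    set (probability (euclid R N * euclid R N)%type R) :=
  [set gamma | forall E, measurable E ->
     gamma (fst @^-1` E) = mu E /\ gamma (snd @^-1` E) = nu E].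

Definition bicausal_coupling (mu nu : probability (euclid R N) R) :
    set (probability (euclid R N * euclid R N)%type R) :=
  [set gamma | [/\ coupling mu nu gamma, causal gamma fst snd &
                   causal gamma snd fst]].

Definition AW2 (mu nu : probability (euclid R N) R) : \bar R :=
  sqrte (ereal_inf
    [set (\int[gamma]_z (enorm (vec z.1 - vec z.2) ^+ 2)%:E)%E
    | gamma in bicausal_coupling mu nu]).

End adapted_wasserstein.

(* Main.v *)
Require Import Defs.
From HB Require Import structures.
From mathcomp Require Import all_boot all_order all_algebra.
From mathcomp Require Import all_classical all_reals all_analysis.
From mathcomp Require Import measurable_realfun ring lra.
Set Implicit Arguments.
Unset Strict Implicit.
Unset Printing Implicit Defensive.
Import Order.TTheory GRing.Theory Num.Theory.
Import numFieldNormedType.Exports.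
Local Open Scope classical_set_scope.
Local Open Scope ring_scope.

(* Write X = a + L G and Y = b + M H with G and H standard Gaussian. The cost
   of a coupling is |a - b|^2 + tr A + tr B - 2 sum_(k,l) (L^T M)_kl E[G_k H_l].
   Since L is triangular, G_s is independent of X_{1:t} for s > t, and causality
   makes it independent of Y_{1:t}, hence of H_t; so bicausality kills all the
   terms with k <> l, and |E[G_k H_k]| <= 1 gives the lower bound. It is attained
   by H_k = sign((L^T M)_kk) G_k, which is bicausal because X and Y are then
   triangular functions of each other. *)

(** The coupling is arbitrary and only its marginals are Gaussian, so the joint law of [(G, H)] is
    known only through what causality says of it. The quadratic cost makes this enough: it involves
    only the pairwise moments of the constant [1], the [G_k] and the [H_l]. Triangularity with a
    nonzero diagonal makes [X_{1:t}] and [G_{1:t}] functions of each other, which is what lets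
    conditions on prefixes of [X] be read on [G]. The passage from the density of [N(a, A)] to the
    law of [a + L G] uses triangularity too: the substitution is made one coordinate at a time, by
    Tonelli and the affine substitution on the line. The factors are mostly required to have a
    nonzero diagonal rather than a positive one. The signs of the optimal coupling are absorbed into
    [M] by flipping some of its columns, which preserves [M *m M^T] but destroys positivity of the
    diagonal. *)

Section density.
Local Open Scope ereal_scope.
Context d (T : measurableType d) (R : realType).
Variables (m m' : {measure set T -> \bar R}) (p : T -> R).
Hypotheses (mp : measurable_fun setT p) (p_ge0 : forall x, (0 <= p x)%R).
Hypothesis m'E : forall A, measurable A -> m' A = \int[m]_(x in A) (p x)%:E.

Import HBNNSimple.

Let sfun_density (h : {nnsfun T >-> R}) :
  \int[m']_x (h x)%:E = \int[m]_x ((h x)%:E * (p x)%:E).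
Proof.
have hE x : (h x)%:E = \sum_(k \in range h) k%:E * (\1_(h @^-1` [set k]) x)%:E.
  by rewrite fsumEFin //= fimfunE.
have mh k : measurable (h @^-1` [set k]) by exact: measurable_sfunP.
have h0 k x : 0 <= k%:E * (\1_(h @^-1` [set k]) x)%:E * (p x)%:E.
  by apply: mule_ge0; [exact: nnfun_muleindic_ge0|rewrite lee_fin].
rewrite integral_nnsfun// patch_setT sintegralE.
under [RHS]eq_integral.
  move=> x _; rewrite hE ge0_mule_fsuml; first over.
  by move=> k; exact: nnfun_muleindic_ge0.
rewrite ge0_integral_fsum//; first last.
  move=> k; apply/emeasurable_funM; last exact/measurable_EFinP.
  by apply: measurable_funeM; exact/measurable_EFinP.
apply: eq_fsbigr => k /[!inE] -[y _ <-].
rewrite m'E// integral_mkcond.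
rewrite -ge0_integralZl ?lee_fin//; first last.
- by move=> x _; rewrite erestrict_ge0// => ? _; rewrite lee_fin.
- apply/(measurable_restrictT _ _).1 => //.
  by apply: measurable_funTS; exact/measurable_EFinP.
apply: eq_integral => x _; rewrite -muleA; congr (_ * _).
by rewrite patchE indicE; case: ifP => _; rewrite ?mul1e ?mul0e.
Qed.

(** For simple functions, [m'E] applies on each level set; monotone convergence along
    [nnsfun_approx] gives the rest. *)
Lemma ge0_integral_density (f : T -> \bar R) :
  measurable_fun setT f -> (forall x, 0 <= f x) ->
  \int[m']_x f x = \int[m]_x (f x * (p x)%:E).
Proof.
move=> mf f0; pose g := nnsfun_approx measurableT mf.
have gf x : EFin (g n x) @[n --> \oo] --> f x.
  by apply: cvg_nnsfun_approx => // y _; exact: f0.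
have ndg x : {homo (g ^~ x) : n k / (n <= k)%N >-> (n <= k)%R}.
  by move=> a b ab; exact/lefP/nd_nnsfun_approx.
transitivity (limn (fun n => \int[m']_x (g n x)%:E)).
  rewrite -monotone_convergence//=.
  - by apply: eq_integral => x _; apply/esym/cvg_lim => //; exact: gf.
  - by move=> n; exact/measurable_EFinP/measurable_funP.
  - by move=> n x _; rewrite lee_fin.
  - by move=> x _ a b ab; rewrite lee_fin ndg.
transitivity (limn (fun n => \int[m]_x ((g n x)%:E * (p x)%:E))).
  by congr (limn _); apply/funext => n; exact: sfun_density.
rewrite -monotone_convergence//=.
- apply: eq_integral => x _; apply/cvg_lim => //.
  by apply: cvgeZr => //; exact: gf.
- move=> n; apply: emeasurable_funM; last exact/measurable_EFinP.
  exact/measurable_EFinP/measurable_funP.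
- by move=> n x _; rewrite mule_ge0 ?lee_fin.
- by move=> x _ a b ab; rewrite lee_pmul ?lee_fin ?ndg.
Qed.

End density.

(** * Affine substitution on the line *)

Section affine.
Local Open Scope ereal_scope.
Context (R : realType).

(** By uniqueness of the Lebesgue measure, it suffices to compare both sides on half-open intervals,
    where only lengths matter. *)
Lemma lebesgue_measure_affine (k c : R) (A : set (measurableTypeR R)) :
  k != 0%R -> measurable A ->
  `|k|%:E * lebesgue_measure ((fun x : measurableTypeR R =>
    (k * x + c)%R : measurableTypeR R) @^-1` A) = lebesgue_measure A.
Proof.
move=> k0 mA; set phi := (X in X @^-1` _).
have mphi : measurable_fun setT phi.
  by apply: measurable_funD => //; exact: measurable_funM.
pose nk : {nonneg R} := NngNum (normr_ge0 k).
pose m' := mscale nk (pushforward (@lebesgue_measure R) phi).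
suff -> : lebesgue_measure A = m' mphi A by [].
apply: lebesgue_measure_unique => //= _ [[a b]] _ <-.
rewrite /m'/= /mscale/= /pushforward/= lebesgue_measure_itv/=.
have [kp|kn] : (0 < k \/ k < 0)%R by apply/orP; rewrite orbC -neq_lt.
- rewrite (_ : _ @^-1` _ = `]((a - c) / k)%R, ((b - c) / k)%R]%classic); last first.
    apply/seteqP; split => x /=; rewrite !in_itv/= /phi => /andP[].
      by move=> ? ?; rewrite ltr_pdivrMr// ler_pdivlMr// mulrC; apply/andP; split; lra.
    rewrite ltr_pdivrMr// ler_pdivlMr// mulrC => ? ?; apply/andP; split; lra.
  rewrite lebesgue_measure_itv/= !lte_fin ltr_pM2r ?invr_gt0// ltrD2r.
  case: ifPn => _; last by rewrite mule0.
  by rewrite -!EFinB -EFinM gtr0_norm//; congr EFin; field.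
(* A negative slope reverses the interval, so its open and closed ends are exchanged; the length is
   unaffected. *)
- rewrite (_ : _ @^-1` _ = `[((b - c) / k)%R, ((a - c) / k)%R[%classic); last first.
    apply/seteqP; split => x /=; rewrite !in_itv/= /phi => /andP[].
      by move=> ? ?; rewrite ltr_ndivlMr// ler_ndivrMr// mulrC; apply/andP; split; lra.
    rewrite ltr_ndivlMr// ler_ndivrMr// mulrC => ? ?; apply/andP; split; lra.
  rewrite lebesgue_measure_itv/= !lte_fin ltr_nM2r ?invr_lt0// ltrD2r.
  case: ifPn => _; last by rewrite mule0.
  by rewrite -!EFinB -EFinM ltr0_norm//; congr EFin; field; rewrite lt_eqF.
Qed.

Lemma ge0_integral_lebesgue_affine (k c : R)
    (f : measurableTypeR R -> \bar R) :
  k != 0%R -> measurable_fun setT f -> (forall x, 0 <= f x) ->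
  `|k|%:E * \int[lebesgue_measure]_x f (k * x + c)%R =
  \int[lebesgue_measure]_x f x.
Proof.
move=> k0 mf f0.
pose phi : measurableTypeR R -> measurableTypeR R := fun x => (k * x + c)%R.
have mphi : measurable_fun setT phi.
  by apply: measurable_funD => //; exact: measurable_funM.
pose nk : {nonneg R} := NngNum (normr_ge0 k).
pose m' := mscale nk (pushforward (@lebesgue_measure R) phi).
rewrite -[RHS](@eq_measure_integral _ _ _ _ lebesgue_measure (m' mphi)); last first.
  by move=> A mA _; rewrite /m'/= /mscale/=; exact: lebesgue_measure_affine.
rewrite ge0_integral_mscale//.
by rewrite ge0_integral_pushforward.
Qed.

End affine.

(** * Images of measures and of probabilities *)

Section image_measure.
Local Open Scope ereal_scope.
Context d1 d2 (X : measurableType d1) (Y : measurableType d2) (R : realType).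
Variables (phi : X -> Y) (m : {measure set X -> \bar R}).
Variable m' : {measure set Y -> \bar R}.
Hypotheses (mphi : measurable_fun setT phi)
  (m'E : forall A, measurable A -> m' A = m (phi @^-1` A)).
Variable f : Y -> \bar R.
Hypothesis mf : measurable_fun setT f.

(** [m'] is only assumed to agree with the pushforward on measurable sets, so that normal laws and
    product measures, which are not pushforwards by definition, can take its place. *)
Lemma ge0_integral_image : (forall y, 0 <= f y) ->
  \int[m']_y f y = \int[m]_x f (phi x).
Proof.
move=> f0; transitivity (\int[pushforward m phi]_y f y).
  by apply: eq_measure_integral => A mA _; exact: m'E.
by rewrite (ge0_integral_pushforward mphi).
Qed.

End image_measure.

Section image_measure_integrable.
Local Open Scope ereal_scope.
Context d1 d2 (X : measurableType d1) (Y : measurableType d2) (R : realType).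
Variables (phi : X -> Y) (m : {measure set X -> \bar R}).
Variable m' : {measure set Y -> \bar R}.
Hypotheses (mphi : measurable_fun setT phi)
  (m'E : forall A, measurable A -> m' A = m (phi @^-1` A)).
Variable f : Y -> \bar R.
Hypothesis mf : measurable_fun setT f.

Lemma integrable_image :
  m'.-integrable setT f <-> m.-integrable setT (f \o phi).
Proof.
have mfphi : measurable_fun setT (f \o phi) by exact: measurableT_comp.
have mabs : measurable_fun setT (fun y => `|f y|) by exact: measurableT_comp.
have absE := ge0_integral_image mphi m'E mabs (fun y => abse_ge0 (f y)).
by split=> /integrableP[_ foo]; apply/integrableP; split => //;
  move: foo; rewrite absE.
Qed.

Lemma integral_image : m'.-integrable setT f ->
  \int[m']_y f y = \int[m]_x f (phi x).
Proof.
move=> /integrable_image fi.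
transitivity (\int[pushforward m phi]_y f y).
  by apply: eq_measure_integral => A mA _; exact: m'E.
by rewrite (integral_pushforward mphi).
Qed.

End image_measure_integrable.

Section push_prob.
Local Open Scope ereal_scope.
Context d1 d2 (X : measurableType d1) (Y : measurableType d2) (R : realType).
Variables (P : probability X R) (phi : X -> Y).
Hypothesis mphi : measurable_fun setT phi.

(** The measurability proof is an argument so that the measure and probability instances below can
    be attached to the term itself. *)
Definition push_prob of measurable_fun setT phi : set Y -> \bar R :=
  pushforward P phi.

Let push_prob0 : push_prob mphi set0 = 0.
Proof. exact: measure0. Qed.

Let push_prob_ge0 A : 0 <= push_prob mphi A.
Proof. exact: measure_ge0. Qed.

Let push_prob_sigma_additive : semi_sigma_additive (push_prob mphi).
Proof. exact: measure_semi_sigma_additive. Qed.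

HB.instance Definition _ := isMeasure.Build _ _ _ (push_prob mphi)
  push_prob0 push_prob_ge0 push_prob_sigma_additive.

Let push_probT : push_prob mphi setT = 1.
Proof. by rewrite /push_prob /pushforward preimage_setT probability_setT. Qed.

HB.instance Definition _ :=
  Measure_isProbability.Build _ _ _ (push_prob mphi) push_probT.

End push_prob.

(** * Triangular changes of variables for the Lebesgue measure on R^n *)

Section tuple_measures.
Local Open Scope ereal_scope.
Context (R : realType).

Lemma measurable_tconsl n (r : measurableTypeR R) :
  measurable_fun setT (fun x : euclid R n => tcons (r, x)).
Proof. by apply: (measurableT_comp (@measurable_tcons R n)). Qed.

Lemma ge0_integral_tcons n (m1 : {sigma_finite_measure set (measurableTypeR R) -> \bar R})
    (m2 : {sigma_finite_measure set (euclid R n) -> \bar R})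
    (f : euclid R n.+1 -> \bar R) :
  measurable_fun setT f -> (forall x, 0 <= f x) ->
  \int[pushforward (m1 \x m2) (@tcons R n)]_x f x =
  \int[m1]_r \int[m2]_x f (tcons (r, x)).
Proof.
move=> mf f0; rewrite (ge0_integral_pushforward (@measurable_tcons R n))//.
rewrite preimage_setT fubini_tonelli1//.
  by apply: (measurableT_comp mf); exact: measurable_tcons.
by move=> x; exact: f0.
Qed.

Lemma ge0_integral_lebesgue_tupleS n (f : euclid R n.+1 -> \bar R) :
  measurable_fun setT f -> (forall x, 0 <= f x) ->
  \int[lebesgue_tuple R n.+1]_x f x =
  \int[lebesgue_measure]_r \int[lebesgue_tuple R n]_x f (tcons (r, x)).
Proof. exact: ge0_integral_tcons. Qed.

Lemma measurable_integral_tcons n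
    (m : {sigma_finite_measure set (euclid R n) -> \bar R})
    (f : euclid R n.+1 -> \bar R) :
  measurable_fun setT f -> (forall x, 0 <= f x) ->
  measurable_fun setT (fun r : measurableTypeR R => \int[m]_x f (tcons (r, x))).
Proof.
move=> mf f0; pose g (z : measurableTypeR R * euclid R n) := f (tcons z).
apply: (@measurable_fun_fubini_tonelli_F _ _ _ _ _ m g) => //.
  by apply: (measurableT_comp mf); exact: measurable_tcons.
by move=> z; exact: f0.
Qed.

(** When [c i] reads only the coordinates before [i], this is a triangular map with Jacobian
    determinant [\prod_i d i]. *)
Definition shear n (d : 'I_n -> R) (c : 'I_n -> euclid R n -> R)
    (x : euclid R n) : euclid R n :=
  [tuple (d i * tnth x i + c i x)%R | i < n].

(** [T] is [R] for a coordinate of a map and [Prop] for an event. The bound is strict, so a map is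
    adapted when its coordinate [i] satisfies this with [i.+1]. *)
Definition depends_below n (i : nat) T (c : euclid R n -> T) :=
  forall x y : euclid R n,
    (forall j : 'I_n, (j < i)%N -> tnth x j = tnth y j) -> c x = c y.

Lemma measurable_shear n (d : 'I_n -> R) (c : 'I_n -> euclid R n -> R) :
  (forall i, measurable_fun setT (c i)) -> measurable_fun setT (shear d c).
Proof.
move=> mc; apply/measurable_fun_tnthP => i.
rewrite (_ : _ \o _ = fun x => (d i * tnth x i + c i x)%R); last first.
  by apply/funext => x /=; rewrite tnth_mktuple.
apply: measurable_funD => //; apply: measurable_funM => //.
exact: measurable_tnth.
Qed.

Lemma tnth_tconsS n (r : measurableTypeR R) (x : euclid R n) i :
  tnth (tcons (r, x)) (lift ord0 i) = tnth x i.
Proof. exact: tnthS. Qed.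

Lemma tnth_tcons0 n (r : measurableTypeR R) (x : euclid R n) :
  tnth (tcons (r, x)) ord0 = r.
Proof. exact: tnth0. Qed.

(** Induction on [n]: the first coordinate undergoes an affine map of the line, and once it is
    frozen at [r] the other coordinates undergo a shear of dimension [n]. *)
Lemma ge0_integral_shear n (d : 'I_n -> R) (c : 'I_n -> euclid R n -> R)
    (f : euclid R n -> \bar R) :
  (forall i, d i != 0%R) -> (forall i, measurable_fun setT (c i)) ->
  (forall i : 'I_n, depends_below i (c i)) ->
  measurable_fun setT f -> (forall x, 0 <= f x) ->
  (\prod_i `|d i|)%:E * \int[lebesgue_tuple R n]_x f (shear d c x) =
  \int[lebesgue_tuple R n]_x f x.
Proof.
elim: n => [|n IH] in d c f *; move=> d0 mc dc mf f0.
  rewrite big_ord0 mul1e; apply: eq_integral => x _.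
  by rewrite (tuple0 (shear d c x)) (tuple0 x).
(* [c ord0] reads no coordinate, hence is constant; its value [c0] may be taken at any point, here
   the origin. *)
pose x0 : euclid R n := [tuple 0%R | i < n].
pose c0 := c ord0 (tcons (0%R, x0)).
pose d' i := d (lift ord0 i).
pose c' (r : measurableTypeR R) i (x : euclid R n) := c (lift ord0 i) (tcons (r, x)).
have shearE r x : shear d c (tcons (r, x)) =
    tcons ((d ord0 * r + c0)%R, shear d' (c' r) x).
  apply: eq_from_tnth => i; rewrite tnth_mktuple.
  case: (unliftP ord0 i) => [j ->|->].
    by rewrite !tnth_tconsS tnth_mktuple.
  by rewrite !tnth_tcons0; congr (_ + _)%R; exact: dc.
have mc' r i : measurable_fun setT (c' r i).
  by apply: (measurableT_comp (mc _)); exact: measurable_tconsl.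
have dc' r (i : 'I_n) : depends_below i (c' r i).
  move=> x y xy; apply: dc => j; case: (unliftP ord0 j) => [k ->|->].
    by rewrite /= /bump/= !add1n ltnS !tnth_tconsS; exact: xy.
  by rewrite !tnth_tcons0.
have mfs : measurable_fun setT (fun x => f (shear d c x)).
  by apply: (measurableT_comp mf); exact: measurable_shear.
have fs0 x : 0 <= f (shear d c x) by exact: f0.
rewrite (ge0_integral_lebesgue_tupleS mfs fs0).
rewrite [RHS]ge0_integral_lebesgue_tupleS//.
rewrite big_ord_recl EFinM -muleA -ge0_integralZl//; first last.
- by rewrite lee_fin; apply: prodr_ge0.
- by move=> r _; apply: integral_ge0 => x _; exact: fs0.
- exact: (measurable_integral_tcons _ mfs fs0).
rewrite -(@ge0_integral_lebesgue_affine R (d ord0) c0)//; first last.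
- by move=> r; apply: integral_ge0 => x _; exact: f0.
- exact: measurable_integral_tcons.
congr (_ * _); apply: eq_integral => r _.
under eq_integral do rewrite shearE.
rewrite -(IH d' (c' r) (fun x => f (tcons ((d ord0 * r + c0)%R, x))))//.
- by move=> i; exact: d0.
- by apply: (measurableT_comp mf); exact: measurable_tconsl.
Qed.

End tuple_measures.

(** * Moments of the standard normal law *)

Section standard_normal.
Context (R : realType).
Local Notation leb := (@lebesgue_measure R).

Lemma normal_pdf01E (x : R) :
  normal_pdf 0 1 x = (Num.sqrt (2 * pi))^-1 * expR (- (x ^+ 2 / 2)) :> R.
Proof.
rewrite normal_pdfE ?oner_neq0// /normal_peak /normal_fun expr1n mul1r subr0.
by rewrite -[pi *+ 2]mulr_natl mulNr.
Qed.

Let g (x : R) : R := normal_pdf 0 1 x.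
Let k : R := (Num.sqrt (2 * pi))^-1.

Let gE : g = fun x => k * expR (- (x ^+ 2 / 2)).
Proof. by apply/funext => x; exact: normal_pdf01E. Qed.

Let g_ge0 x : 0 <= g x. Proof. exact: normal_pdf_ge0. Qed.

Let cg : continuous g. Proof. exact/continuous_normal_pdf/oner_neq0. Qed.

Let is_derive_g (x : R) : is_derive x (1 : R) (fun x => - g x) (x * g x).
Proof.
rewrite gE; apply: is_derive_eq.
rewrite /GRing.scale/=.
by field.
Qed.

Let cvg_g : - g x @[x --> +oo] --> (0 : R).
Proof.
rewrite gE -oppr0; apply: cvgN; rewrite -[in X in _ --> X](mulr0 k).
apply: cvgM; first exact: cvg_cst.
apply: (cvg_comp (fun x => x ^+ 2 / 2) (fun x => expR (- x))); last exact: cvgr_expR.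
by apply: gt0_cvgMly; [rewrite invr_gt0|exact: cvgr_expr2].
Qed.

(** The function [- g] is an antiderivative of [u * g u] and vanishes at infinity. *)
Let tail (x : R) : 0 <= x ->
  (\int[leb]_(u in `[x, +oo[) (u * g u)%:E = (g x)%:E)%E.
Proof.
move=> x0; have cf : continuous (fun u : R => u * g u).
  by move=> u; apply: cvgM; [exact: cvg_id|exact: cg].
rewrite (@ge0_continuous_FTC2y _ _ (fun x => - g x) x 0).
- by rewrite EFinN oppeK add0e.
- by move=> u xu; rewrite mulr_ge0// (le_trans x0).
- exact: continuous_subspaceT.
- exact: cvg_g.
- by move=> u _; have [] := is_derive_g u.
- apply: cvg_at_right_filter; apply: cvgN; exact: cg.
- by move=> u _; rewrite derive1E; have [_ ->] := is_derive_g u.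
Qed.

Let A : set (measurableTypeR R * measurableTypeR R) := [set z | 0 <= z.1 <= z.2].

Let inAE x u : ((x, u) \in A) = (0 <= x <= u).
Proof. by apply/idP/idP; rewrite inE. Qed.

Let mA : measurable A.
Proof.
rewrite (_ : A = [set z | 0 <= z.1] `&` [set z | z.1 <= z.2]); last first.
  by apply/seteqP; split => z /=; [case/andP|case=> ? ?; apply/andP].
apply: measurableI.
  rewrite -[X in measurable X]setTI.
  rewrite (_ : [set _ | _] = fst @^-1` `[0, +oo[%classic); last first.
    by apply/seteqP; split => z /=; rewrite in_itv/= andbT.
  exact: measurable_fst.
rewrite -[X in measurable X]setTI.
rewrite (_ : [set _ | _] =
    (fun z => z.2 - z.1 : measurableTypeR R) @^-1` `[0, +oo[%classic); last first.
  by apply/seteqP; split => z /=; rewrite in_itv/= andbT subr_ge0.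
suff : measurable_fun setT (fun z : measurableTypeR R * measurableTypeR R =>
  z.2 - z.1 : measurableTypeR R) by exact.
exact: measurable_funB.
Qed.

Let F (z : measurableTypeR R * measurableTypeR R) : \bar R :=
  (z.2 * g z.2 * \1_A z)%:E.

Let F_ge0 z : (0 <= F z)%E.
Proof.
rewrite lee_fin indicE; case: (boolP (z \in A)) => [|_]; last by rewrite mulr0.
by rewrite inE => /andP[z1 z2]; rewrite mulr1 mulr_ge0// (le_trans z1).
Qed.

Let mF : measurable_fun setT F.
Proof.
apply/measurable_EFinP; apply: measurable_funM; last exact: measurable_indic.
apply: measurable_funM => //.
apply: (measurableT_comp (measurable_normal_pdf 0 1)); exact: measurable_snd.
Qed.

(* Tonelli applied to g x = \int_(x <= u) u * g u over x >= 0. *)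
Let half_second_moment :
  (\int[leb]_(x in `[0%R, +oo[) (x ^+ 2 * g x)%:E =
   \int[leb]_(x in `[0%R, +oo[) (g x)%:E)%E.
Proof.
have := sfinite_Fubini leb leb F F_ge0 mF.
rewrite [in X in X = _ -> _](_ : (fun x => _) =
    (fun x => (g x)%:E) \_ `[0%R, +oo[); last first.
  apply/funext => x; rewrite patchE mem_setE in_itv/= andbT.
  case: ifPn => x0; last first.
    apply: integral0_eq => u _; rewrite /F/= indicE memNset ?mulr0//.
    by rewrite /A/= (negbTE x0).
  rewrite -tail// [RHS]integral_mkcond; apply: eq_integral => u _.
  rewrite /F patchE indicE.
  have -> : ((x, u) \in A) = (x <= u) by rewrite inAE x0.
  rewrite mem_setE in_itv/= andbT.
  by case: ifP => _; rewrite ?mulr1 ?mulr0.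
rewrite -integral_mkcond => ->.
rewrite integral_mkcond; apply: eq_integral => u _.
rewrite patchE mem_setE in_itv/= andbT; case: ifPn => u0; last first.
  apply/esym; apply: integral0_eq => x _; rewrite /F/= indicE memNset ?mulr0//.
  by rewrite /A/= => /andP[x0 xu]; move: u0; rewrite (le_trans x0 xu).
(* In the other order of integration, [u * g u] is constant on [[0, u]], and the length of this
   interval supplies the second factor [u]. *)
transitivity (\int[leb]_x ((u * g u)%:E * (\1_(`[0%R, u]) x)%:E))%E; last first.
  by apply: eq_integral => x _; rewrite /F/= -EFinM; congr (_ * _)%:E.
rewrite ge0_integralZl//; first last.
- by rewrite lee_fin mulr_ge0.
- by apply/measurable_EFinP; exact: measurable_indic.
rewrite integral_indic// setIT.
rewrite (_ : _ `[0%R, u]%classic = lebesgue_measure (`[0%R, u]%classic : set R))//.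
rewrite lebesgue_measure_itv/= lte_fin.
case: ltgtP u0 => // [u0 _|<- _]; last by rewrite expr0n/= !mul0r mule0.
by rewrite -EFinB subr0 -EFinM expr2 mulrAC.
Qed.

(** Both [x ^+ 2 * g x] and [g x] are even, so the identity on the half-line doubles to the total
    mass of the density. *)
Lemma second_moment_normal :
  (\int[normal_prob 0 1]_x (x ^+ 2)%:E = 1 :> \bar R)%E.
Proof.
have mg : measurable_fun setT g by exact: measurable_normal_pdf.
rewrite (@ge0_integral_density _ _ _ leb _ g)//; first last.
- by move=> x; rewrite lee_fin sqr_ge0.
- by apply/measurable_EFinP; exact: measurable_funX.
under eq_integral do rewrite -EFinM.
have c2 : continuous (fun x : R => x ^+ 2 * g x).
  by move=> x; apply: cvgM; [exact: exprn_continuous|exact: cg].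
have gN x : g x = g (- x) by rewrite gE sqrrN.
have itvE : [set x : R | 0 <= x] = `[0, +oo[%classic.
  by apply/seteqP; split => x /=; rewrite in_itv/= andbT.
rewrite ge0_symfun_integralT//; first last.
- by move=> x /=; rewrite -gN sqrrN.
- by move=> x; rewrite mulr_ge0// sqr_ge0.
rewrite itvE half_second_moment -itvE -ge0_symfun_integralT//.
exact: integral_normal_pdf.
Qed.

Lemma integrable_normal_sqr :
  (normal_prob (0 : R) 1).-integrable setT (fun x => (x ^+ 2)%:E).
Proof.
apply/integrableP; split; first by apply/measurable_EFinP; exact: measurable_funX.
under eq_integral do rewrite /= ger0_norm ?sqr_ge0//.
by rewrite second_moment_normal ltry.
Qed.

Lemma integrable_normal_id :
  (normal_prob (0 : R) 1).-integrable setT (fun x => x%:E).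
Proof.
have I2 : (normal_prob (0 : R) 1).-integrable setT (fun x => (1 + x ^+ 2)%:E).
  rewrite (_ : (fun _ => _) = cst 1%E \+ (fun x : R => (x ^+ 2)%:E))%E//.
  apply: integrableD => //; last exact: integrable_normal_sqr.
  exact: finite_measure_integrable_cst.
apply: le_integrable I2 => //; first exact: EFin_measurable.
move=> x _; rewrite /= lee_fin [leRHS]ger0_norm ?addr_ge0 ?sqr_ge0//.
rewrite -[x ^+ 2]real_normK ?num_real//.
by have := sqr_ge0 (`|x| - 1); nra.
Qed.

Lemma normal_probN (B : set (measurableTypeR R)) : measurable B ->
  normal_prob (0 : R) 1 B = normal_prob 0 1 ((fun x => - x) @^-1` B).
Proof.
move=> mB; have mN : measurable ((fun x => - x) @^-1` B : set (measurableTypeR R)).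
  by rewrite -[X in measurable X]setTI; exact: (@oppr_measurable R).
have mgE : measurable_fun setT (EFin \o g).
  by apply/measurable_EFinP; exact: measurable_normal_pdf.
rewrite /normal_prob integral_mkcond.
rewrite -(@ge0_integral_lebesgue_affine R (-1) 0)//; first last.
- by move=> x; apply: erestrict_ge0 => y _; rewrite lee_fin g_ge0.
- by apply/(measurable_restrictT _ _).1 => //; exact: measurable_funTS.
rewrite normrN1 mul1e [RHS]integral_mkcond; apply: eq_integral => x _.
rewrite !patchE mulN1r addr0; congr (if _ then (_)%:E else _).
by rewrite -!/(g _) gE sqrrN.
Qed.

(** The law is invariant under negation, so the mean equals its own opposite; integrability makes it
    finite, hence zero. *)
Lemma first_moment_normal :
  (\int[normal_prob 0 1]_x x%:E = 0 :> \bar R)%E.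
Proof.
have mN : measurable_fun setT (fun x : measurableTypeR R => - x : measurableTypeR R).
  exact: oppr_measurable.
have I0 := integrable_normal_id.
have E : (\int[normal_prob 0 1]_x x%:E = \int[normal_prob 0 1]_x (- x)%:E :> \bar R)%E.
  exact: (integral_image mN normal_probN (@EFin_measurable R setT) I0).
have E2 : (\int[normal_prob 0 1]_x (- x)%:E =
    (-1)%:E * \int[normal_prob 0 1]_x x%:E :> \bar R)%E.
  by rewrite -integralZl//; apply: eq_integral => x _; rewrite -EFinM mulN1r.
have {I0} fin_I := integrable_fin_num measurableT I0.
move: E; rewrite E2 -(fineK fin_I) -EFinM => -[] rN.
by congr EFin; lra.
Qed.

End standard_normal.

(** * Gaussian laws as affine images of the standard Gaussian law *)

Section standard_gaussian.
Local Open Scope ereal_scope.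
Context (R : realType).

(** The law of [n] independent standard normal variables. The recursion parallels [lebesgue_tuple],
    so that the two measures can be compared one coordinate at a time. *)
Fixpoint stdg n : probability (euclid R n) R :=
  if n is n'.+1 then
    push_prob (normal_prob 0 1 \x stdg n') (@measurable_tcons R n')
  else \d_([tuple] : euclid R 0).

Lemma stdgS n A : stdg n.+1 A =
  \int[normal_prob 0 1]_r stdg n ((fun x => tcons (r, x)) @^-1` A).
Proof.
apply: eq_integral => r _ /=; congr (stdg n _).
by apply/seteqP; split => x; rewrite /xsection/= inE.
Qed.

Lemma ge0_integral_stdgS n (f : euclid R n.+1 -> \bar R) :
  measurable_fun setT f -> (forall x, 0 <= f x) ->
  \int[stdg n.+1]_x f x =
  \int[normal_prob 0 1]_r \int[stdg n]_x f (tcons (r, x)).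
Proof. exact: ge0_integral_tcons. Qed.

Definition stdg_pdf n (x : euclid R n) : R :=
  (\prod_i normal_pdf 0 1 (tnth x i))%R.

Lemma stdg_pdf_ge0 n (x : euclid R n) : (0 <= stdg_pdf x)%R.
Proof. by apply: prodr_ge0 => i _; exact: normal_pdf_ge0. Qed.

Lemma measurable_stdg_pdf n : measurable_fun setT (@stdg_pdf n).
Proof.
apply: measurable_prod => i _.
by apply: (measurableT_comp (measurable_normal_pdf 0 1)); exact: measurable_tnth.
Qed.

Lemma ge0_integral_stdg n (f : euclid R n -> \bar R) :
  measurable_fun setT f -> (forall x, 0 <= f x) ->
  \int[stdg n]_x f x = \int[lebesgue_tuple R n]_x (f x * (stdg_pdf x)%:E).
Proof.
elim: n => [|n IH] in f * => mf f0.
  by apply: eq_integral => x _; rewrite /stdg_pdf big_ord0 mule1.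
have mfp : measurable_fun setT (fun x => f x * (stdg_pdf x)%:E).
  apply: emeasurable_funM => //; apply/measurable_EFinP.
  exact: measurable_stdg_pdf.
have fp0 n' (x : euclid R n') (y : \bar R) : 0 <= y -> 0 <= y * (stdg_pdf x)%:E.
  by move=> y0; rewrite mule_ge0// lee_fin stdg_pdf_ge0.
rewrite ge0_integral_stdgS//.
rewrite ge0_integral_lebesgue_tupleS//; last by move=> x; exact: fp0.
rewrite (@ge0_integral_density _ _ _ lebesgue_measure _ (normal_pdf 0 1))//; first last.
- by move=> r; apply: integral_ge0 => x _; exact: f0.
- exact: measurable_integral_tcons.
- by move=> r; exact: normal_pdf_ge0.
- exact: measurable_normal_pdf.
apply: eq_integral => r _; rewrite IH//; last first.
  by apply: (measurableT_comp mf); exact: measurable_tconsl.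
rewrite -ge0_integralZr//; first last.
- by rewrite lee_fin normal_pdf_ge0.
- by move=> x _; exact: fp0.
- apply: emeasurable_funM.
    by apply: (measurableT_comp mf); exact: measurable_tconsl.
  by apply/measurable_EFinP; exact: measurable_stdg_pdf.
apply: eq_integral => x _; rewrite -muleA -EFinM; congr (_ * _%:E).
rewrite /stdg_pdf big_ord_recl tnth_tcons0 mulrC; congr (_ * _)%R.
by apply: eq_bigr => i _; rewrite tnth_tconsS.
Qed.

Lemma measurable_stdg_section n (A : set (euclid R n.+1)) : measurable A ->
  measurable_fun setT (fun r : measurableTypeR R =>
    stdg n ((fun x => tcons (r, x)) @^-1` A)).
Proof.
move=> mA; have mtA : measurable (@tcons R n @^-1` A).
  by rewrite -[X in measurable X]setTI; exact: measurable_tcons.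
have := measurable_fun_xsection (stdg n) mtA; congr measurable_fun.
apply/funext => r /=; congr (stdg n _).
by apply/seteqP; split => x; rewrite /xsection/= inE.
Qed.

(** Independence of coordinate [i] from the earlier ones, by induction on [n]: fixing the first
    coordinate lowers [i] by one. *)
Lemma stdg_indep n (i : 'I_n) (S : set (euclid R n)) (D : set (measurableTypeR R)) :
  measurable S -> measurable D -> depends_below i S ->
  stdg n (S `&` [set x | D (tnth x i)]) = stdg n S * normal_prob 0 1 D.
Proof.
move=> mS mD; elim: n => [|n IH] in i S mS *; first by case: i.
move=> dS; rewrite stdgS; case: (unliftP ord0 i) => [j ij|i0].
  have mSr r : measurable ((fun x => tcons (r, x)) @^-1` S).
    by rewrite -[X in measurable X]setTI; exact: measurable_tconsl.
  transitivity (\int[normal_prob 0 1]_r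
     (stdg n ((fun x => tcons (r, x)) @^-1` S) * normal_prob 0 1 D)).
    apply: eq_integral => r _; rewrite -(IH j)//.
      congr (stdg n _); apply/seteqP; split => x /=;
      by rewrite ij tnth_tconsS.
    move=> x y xy; apply: dS => l; case: (unliftP ord0 l) => [k ->|->].
      by rewrite ij /= /bump/= !add1n ltnS !tnth_tconsS; exact: xy.
    by rewrite !tnth_tcons0.
  by rewrite ge0_integralZr// ?stdgS//; exact: (measurable_stdg_section mS).
(* Here [i] is the first coordinate, so membership in [S] depends on nothing. *)
have S0T : S = set0 \/ S = setT.
  have [[y Sy]|nSx] := pselect (exists x, S x).
    by right; apply/seteqP; split => // x _; rewrite (dS x y)// i0.
  by left; apply/seteqP; split => // x Sx; apply: nSx; exists x.
case: S0T => ->.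
  by rewrite measure0 mul0e; apply: integral0_eq => r _; rewrite set0I measure0.
rewrite probability_setT mul1e -[D in RHS]setIT -integral_indic//.
apply: eq_integral => r _; rewrite setTI indicE.
case: (boolP (r \in D)) => [/set_mem|/negP] rD.
  rewrite [X in stdg n X](_ : _ = setT) ?probability_setT//.
  by apply/seteqP; split => // x _ /=; rewrite i0 tnth_tcons0.
rewrite [X in stdg n X](_ : _ = set0) ?measure0//.
apply/seteqP; split => // x /=; rewrite i0 tnth_tcons0 => Dr.
by apply: rD; exact: mem_set.
Qed.

Lemma stdg_marginal n (i : 'I_n) (D : set (measurableTypeR R)) : measurable D ->
  normal_prob 0 1 D = stdg n [set x | D (tnth x i)].
Proof.
by move=> mD; rewrite -[X in stdg n X]setTI stdg_indep// probability_setT mul1e.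
Qed.

End standard_gaussian.

Section gaussian_affine.
Context (R : realType) (N : nat).

Definition affine (a : 'cV[R]_N) (L : 'M[R]_N) (x : euclid R N) : euclid R N :=
  [tuple a i ord0 + \sum_j L i j * tnth x j | i < N].

Lemma vec_affine a L x : vec (affine a L x) = a + L *m vec x.
Proof.
apply/colP => i; rewrite !mxE tnth_mktuple.
by congr (_ + _); apply: eq_bigr => j _; rewrite !mxE.
Qed.

Lemma measurable_affine a L : measurable_fun setT (affine a L).
Proof.
apply/measurable_fun_tnthP => i.
rewrite (_ : _ \o _ = fun x => a i ord0 + \sum_j L i j * tnth x j); last first.
  by apply/funext => x /=; rewrite tnth_mktuple.
apply: measurable_funD => //; apply: measurable_sum => j.
by apply: measurable_funM => //; exact: measurable_tnth.
Qed.

Lemma affine_shear a (L : 'M[R]_N) : is_trig_mx L -> affine a L =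
  shear (fun i => L i i) (fun i x => a i ord0 + \sum_(j < N | (j < i)%N) L i j * tnth x j).
Proof.
move=> /is_trig_mxP Ltrig; apply/funext => x.
apply: eq_from_tnth => i; rewrite !tnth_mktuple addrCA; congr (_ + _).
rewrite (bigD1 i)//=; congr (_ + _).
rewrite [LHS](bigID (fun j : 'I_N => (j < i)%N))/= [X in _ + X]big1 ?addr0.
  by apply: eq_bigl => j; rewrite -val_eqE/= ltn_neqAle; case: eqP.
by move=> j; rewrite -leqNgt -val_eqE => /andP[ji ij]; rewrite Ltrig ?mul0r// ltn_neqAle eq_sym ji.
Qed.

Lemma measurable_gaussian_pdf (a : 'cV[R]_N) (A : 'M[R]_N) :
  measurable_fun setT (fun x : euclid R N => gaussian_pdf a A (vec x)).
Proof.
apply: measurable_funM => //; apply: measurableT_comp => //.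
apply: measurable_funM => //; apply: measurableT_comp => //.
rewrite (_ : (fun _ => _) = fun x : euclid R N => \sum_k (\sum_j (tnth x j - a j ord0) *
    invmx A j k) * (tnth x k - a k ord0)); last first.
  apply/funext => x; rewrite mxE; apply: eq_bigr => k _; rewrite !mxE.
  by congr (_ * _); apply: eq_bigr => j _; rewrite !mxE.
have mt j : measurable_fun setT (fun x : euclid R N => tnth x j - a j ord0).
  by apply: measurable_funB => //; exact: measurable_tnth.
apply: measurable_sum => k; apply: measurable_funM => //.
by apply: measurable_sum => j; exact: measurable_funM.
Qed.

(** The quadratic form of [invmx (L *m L^T)] at [L *m vec x] is the squared length of [x], and the
    square root of [\det (L *m L^T)] is the absolute Jacobian, which cancels. *)
Lemma gaussian_pdf_affine (a : 'cV[R]_N) (L : 'M[R]_N) (x : euclid R N) :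
  is_trig_mx L -> (forall i, L i i != 0) ->
  (\prod_i `|L i i|) * gaussian_pdf a (L *m L^T) (vec (affine a L x)) = stdg_pdf x.
Proof.
move=> Ltrig L0.
have detL : \det L = \prod_i L i i by exact: det_trig.
have detL0 : \det L != 0 by rewrite detL; apply/prodf_neq0.
have uL : L \in unitmx by rewrite unitmxE unitfE.
have uLT : L^T \in unitmx by rewrite unitmx_tr.
rewrite /gaussian_pdf vec_affine addrC addKr.
have -> : (L *m vec x)^T *m invmx (L *m L^T) *m (L *m vec x) = (vec x)^T *m vec x.
  have QL : invmx (L *m L^T) *m L = invmx L^T.
    by rewrite -[LHS](mulmxK uLT) -(mulmxA _ L) mulVmx ?unitmx_mul ?uL// mul1mx.
  by rewrite trmx_mul !mulmxA -(mulmxA _ _ L) QL -(mulmxA _ L^T) mulmxV// mulmx1.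
rewrite mxE det_mulmx det_tr -expr2 sqrtrM; last by rewrite exprn_ge0// mulr_ge0// pi_ge0.
rewrite sqrtr_sqr detL normr_prod invfM mulrCA mulrA mulfVK; last first.
  by apply/prodf_neq0 => i _; rewrite normr_eq0.
rewrite /stdg_pdf.
under [RHS]eq_bigr do rewrite normal_pdf01E.
rewrite big_split/= prodr_const card_ord exprVn.
have -> : Num.sqrt ((2 * pi) ^+ N) = Num.sqrt (2 * pi) ^+ N :> R.
  elim: N => [|n IH]; first by rewrite !expr0 sqrtr1.
  by rewrite exprS sqrtrM ?IH ?exprS// mulr_ge0// pi_ge0.
congr (_ * _); rewrite -expR_sum; congr expR.
rewrite -sumrN mulr_suml; apply: eq_bigr => i _.
by rewrite !mxE -expr2 mulNr.
Qed.

Lemma gaussian_image (mu : probability (euclid R N) R) (a : 'cV[R]_N)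
    (L : 'M[R]_N) (E : set (euclid R N)) :
  is_trig_mx L -> (forall i, L i i != 0) -> is_gaussian mu a (L *m L^T) ->
  measurable E -> mu E = stdg R N (affine a L @^-1` E).
Proof.
move=> Ltrig L0 hmu mE.
have maff := measurable_affine a L.
have mpE : measurable (affine a L @^-1` E).
  by rewrite -[X in measurable X]setTI; exact: maff.
have pdf0 x : (0 <= (gaussian_pdf a (L *m L^T) x)%:E)%E.
  by rewrite lee_fin /gaussian_pdf mulr_ge0 ?expR_ge0// invr_ge0 sqrtr_ge0.
have mpdf : measurable_fun setT
    (fun x : euclid R N => (gaussian_pdf a (L *m L^T) (vec x))%:E).
  by apply/measurable_EFinP; exact: measurable_gaussian_pdf.
rewrite hmu// integral_mkcond; set f := (X in integral _ _ X).
have mf : measurable_fun setT f.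
  by apply/(measurable_restrictT _ _).1 => //; exact: measurable_funTS.
have f0 x : (0 <= f x)%E by apply: erestrict_ge0.
have dep (i : 'I_N) : depends_below i (fun x : euclid R N =>
    a i ord0 + \sum_(j < N | (j < i)%N) L i j * tnth x j).
  by move=> x y xy; congr (_ + _); apply: eq_bigr => j /xy ->.
rewrite -(ge0_integral_shear L0 _ dep)//; last first.
  move=> i; apply: measurable_funD => //; under eq_fun do rewrite big_mkcond/=.
  apply: measurable_sum => j; have [_|_] := boolP (j < i)%N => //.
  by apply: measurable_funM => //; exact: measurable_tnth.
rewrite -affine_shear//.
have -> : stdg R N (affine a L @^-1` E) =
    (\int[stdg R N]_x (\1_(affine a L @^-1` E) x)%:E)%E.
  by rewrite integral_indic// setIT.
rewrite ge0_integral_stdg//; last first.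
  by apply/measurable_EFinP; exact: measurable_indic.
have P0 : (0 <= (\prod_i `|L i i|)%:E)%E by rewrite lee_fin; apply: prodr_ge0.
rewrite -ge0_integralZl//; first last.
- exact: (measurableT_comp mf maff).
apply: eq_integral => x _; rewrite /f patchE indicE.
have -> : (x \in affine a L @^-1` E) = (affine a L x \in E).
  by apply/idP/idP; rewrite !inE.
case: ifP => _; last by rewrite mule0 mul0e.
by rewrite mul1e -EFinM gaussian_pdf_affine.
Qed.

End gaussian_affine.

(** * Independence and causality *)

Section integral_independent.
Local Open Scope ereal_scope.
Context d (T : measurableType d) (R : realType) (P : {measure set T -> \bar R}).
Variables (B : set T) (c : {nonneg R}) (h : T -> \bar R).
Hypotheses (mB : measurable B) (mh : measurable_fun setT h).
Hypothesis indep : forall U, measurable U ->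
  P (h @^-1` U `&` B) = c%:num%:E * P (h @^-1` U).

(** [indep] says that the image under [h] of [P] restricted to [B] is [c] times the image of [P].
    Taking for [psi] the positive and the negative part then covers signed [h]. *)
Let ge0_integral_indep (psi : \bar R -> \bar R) :
  measurable_fun setT psi -> (forall y, 0 <= psi y) ->
  \int[P]_(x in B) psi (h x) = c%:num%:E * \int[P]_x psi (h x).
Proof.
move=> mpsi psi0; have mpsih : measurable_fun setT (fun x => psi (h x)).
  exact: measurableT_comp.
pose nu (_ : measurable_fun setT h) := pushforward (mrestr P mB) h.
transitivity (\int[nu mh]_y psi y).
  rewrite (@ge0_integral_image _ _ _ _ _ h (mrestr P mB))//.
  rewrite (@ge0_integral_density _ _ _ P _ (\1_B)%R)//.
  - rewrite integral_mkcond; apply: eq_integral => x _.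
    by rewrite patchE indicE; case: ifP => _; rewrite ?mule1 ?mule0.
  - by move=> A mA; rewrite integral_indic// /mrestr setIC.
rewrite -ge0_integral_mscale//.
rewrite (@ge0_integral_image _ _ _ _ _ h (mscale c P))//.
Qed.

Lemma integral_indep : P.-integrable setT h ->
  \int[P]_(x in B) h x = c%:num%:E * \int[P]_x h x.
Proof.
move=> hi; rewrite [LHS]integralE [X in _ = _ * X]integralE.
have pE : h^\+ = (fun x => (idfun^\+ (h x))) by apply/funext => x; rewrite !funeposE.
have nE : h^\- = (fun x => (idfun^\- (h x))) by apply/funext => x; rewrite !funenegE.
rewrite muleBr//; last first.
  by apply: fin_num_adde_defr; exact: integrable_pos_fin_num.
have mid : measurable_fun setT (idfun : \bar R -> \bar R) by exact: measurable_id.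
rewrite pE nE (ge0_integral_indep (measurable_funepos mid) (funepos_ge0 _)).
by rewrite (ge0_integral_indep (measurable_funeneg mid) (funeneg_ge0 _)).
Qed.

End integral_independent.

Section standard_normal_variables.
Local Open Scope ereal_scope.
Context d (T : measurableType d) (R : realType) (P : probability T R).

Implicit Types U V : T -> measurableTypeR R.

Definition std_normal U := measurable_fun setT U /\
  forall D : set (measurableTypeR R), measurable D ->
    normal_prob 0 1 D = P (U @^-1` D).

Lemma std_normal_sqr U : std_normal U ->
  P.-integrable setT (fun x => (U x ^+ 2)%:E) /\ \int[P]_x (U x ^+ 2)%:E = 1.
Proof.
move=> [mU UE]; have msq : measurable_fun setT (fun x : measurableTypeR R => (x ^+ 2)%:E).
  by apply/measurable_EFinP; exact: measurable_funX.
have I2 := @integrable_normal_sqr R; split.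
  by have /(integrable_image mU UE msq) := I2.
by rewrite -(integral_image mU UE msq I2) second_moment_normal.
Qed.

Lemma std_normal_id U : std_normal U ->
  P.-integrable setT (fun x => (U x)%:E) /\ \int[P]_x (U x)%:E = 0.
Proof.
move=> [mU UE]; have mE := @EFin_measurable R setT.
have I1 := @integrable_normal_id R; split.
  by have /(integrable_image mU UE mE) := I1.
by rewrite -(integral_image mU UE mE I1) first_moment_normal.
Qed.

Lemma std_normal_integrableM U V : std_normal U -> std_normal V ->
  P.-integrable setT (fun x => (U x * V x)%:E).
Proof.
move=> sU sV; have [U2 _] := std_normal_sqr sU; have [V2 _] := std_normal_sqr sV.
have UV2 : P.-integrable setT (fun x => (U x ^+ 2 + V x ^+ 2)%:E).
  by have := integrableD measurableT U2 V2; apply: eq_integrable.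
apply: le_integrable UV2 => //.
  by apply/measurable_EFinP; apply: measurable_funM; [case: sU|case: sV].
move=> x _; rewrite /= lee_fin [leRHS]ger0_norm ?addr_ge0 ?sqr_ge0//.
rewrite normrM -(real_normK (num_real (U x))) -(real_normK (num_real (V x))).
by have := sqr_ge0 (`|U x| - `|V x|)%R; have := mulr_ge0 (normr_ge0 (U x)) (normr_ge0 (V x)); nra.
Qed.

(** Agreement on rectangles identifies the joint law with the product of two normal laws; Fubini
    then factors out a mean, which is zero. *)
Lemma std_normal_indepM U V : std_normal U -> std_normal V ->
  (forall D E : set (measurableTypeR R), measurable D -> measurable E ->
    P (U @^-1` D `&` V @^-1` E) = P (U @^-1` D) * P (V @^-1` E)) ->
  \int[P]_x (U x * V x)%:E = 0.
Proof.
move=> sU sV UV; have [mU UE] := sU; have [mV VE] := sV.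
pose N : probability (measurableTypeR R) R := normal_prob 0 1.
pose W x : measurableTypeR R * measurableTypeR R := (U x, V x).
have mW : measurable_fun setT W by exact: measurable_fun_pair.
pose nu (_ : measurable_fun setT W) := pushforward P W.
have NE A : measurable A -> (N \x N) A = P (W @^-1` A).
  apply: (@product_measure_unique _ _ _ _ _ N N (nu mW)) => D E mD mE.
  transitivity (P (U @^-1` D) * P (V @^-1` E)); first by rewrite -UV.
  by congr (_ * _); apply/esym; [exact: UE|exact: VE].
pose f (z : measurableTypeR R * measurableTypeR R) := (z.1 * z.2)%:E.
have mf : measurable_fun setT f by apply/measurable_EFinP; exact: measurable_funM.
have fi : (N \x N).-integrable setT f.
  by apply/(integrable_image mW NE mf); exact: std_normal_integrableM.
rewrite -(integral_image mW NE mf fi) -(integral12_prod_meas1 fi).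
apply: integral0_eq => x _; rewrite /fubini_F /f/=.
under eq_integral do rewrite EFinM.
rewrite integralZl//; last exact: integrable_normal_id.
by rewrite first_moment_normal mule0.
Qed.

End standard_normal_variables.

(** * Prefixes of paths and inverses of triangular affine maps *)

Section prefixes.
Context (R : realType) (N : nat).

Lemma measurable_tprefix t (tN : (t <= N)%N) : measurable_fun setT (@tprefix R N t tN).
Proof.
apply/measurable_fun_tnthP => i.
rewrite (_ : _ \o _ = fun x => tnth x (widen_ord tN i)); first exact: measurable_tnth.
by apply/funext => x /=; rewrite tnth_mktuple.
Qed.

(** The padding by [0] is arbitrary: composing with this map exhibits a function of the first [t]
    coordinates as a measurable function of the prefix. *)
Definition textend t (z : euclid R t) : euclid R N := [tuple nth 0 z i | i < N].

Lemma measurable_textend t : measurable_fun setT (@textend t).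
Proof.
apply/measurable_fun_tnthP => i.
have [it|ti] := ltnP i t.
  rewrite (_ : _ \o _ = fun x => tnth x (Ordinal it)); first exact: measurable_tnth.
  by apply/funext => x /=; rewrite tnth_mktuple (tnth_nth 0).
rewrite (_ : _ \o _ = cst 0) //.
by apply/funext => x /=; rewrite tnth_mktuple nth_default// size_tuple.
Qed.

Lemma depends_below_tprefix t (tN : (t <= N)%N) T (f : euclid R N -> T) x :
  depends_below t f -> f (textend (tprefix tN x)) = f x.
Proof.
apply => j jt; rewrite tnth_mktuple.
by rewrite -(tnth_nth 0 _ (Ordinal jt)) tnth_mktuple; congr tnth; exact/val_inj.
Qed.

End prefixes.

Section whitening.
Context (R : realType) (N : nat).
Implicit Types (a : 'cV[R]_N) (L : 'M[R]_N).

Lemma vec_inj : injective (@vec R N).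
Proof.
move=> x y /colP xy; apply: eq_from_tnth => i.
by have := xy i; rewrite !mxE.
Qed.

Definition whiten a L : euclid R N -> euclid R N :=
  affine (- (invmx L *m a)) (invmx L).

Lemma unitmx_trig L : is_trig_mx L -> (forall i, L i i != 0) -> L \in unitmx.
Proof.
move=> Ltrig L0; rewrite unitmxE unitfE det_trig//; exact/prodf_neq0.
Qed.

Lemma affineK a L : L \in unitmx -> cancel (affine a L) (whiten a L).
Proof.
move=> uL x; apply: vec_inj; rewrite !vec_affine mulmxDr addKr.
by rewrite mulKmx.
Qed.

Lemma whitenK a L : L \in unitmx -> cancel (whiten a L) (affine a L).
Proof.
move=> uL x; apply: vec_inj; rewrite !vec_affine mulmxDr mulmxN !mulKVmx//.
by rewrite addrA subrr add0r.
Qed.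

Lemma affine_depends_below a L (i : 'I_N) : is_trig_mx L ->
  depends_below i.+1 (fun x => tnth (affine a L x) i).
Proof.
move=> /is_trig_mxP Ltrig x y xy; rewrite !tnth_mktuple; congr (_ + _).
apply: eq_bigr => j _; have [ij|ji] := ltnP i j; first by rewrite Ltrig// !mul0r.
by rewrite xy.
Qed.

(** Forward substitution, which spares a proof that [invmx L] is triangular: if two images under
    [affine a L] agree up to index [i], so do the preimages, by strong induction and cancellation of
    [L i i]. *)
Lemma whiten_depends_below a L (i : 'I_N) : is_trig_mx L ->
  (forall j, L j j != 0) -> depends_below i.+1 (fun x => tnth (whiten a L x) i).
Proof.
move=> Ltrig L0 x y; have uL := unitmx_trig Ltrig L0.
rewrite -{1}(whitenK a uL x) -{1}(whitenK a uL y).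
move: (whiten a L x) (whiten a L y) => {x y} x y.
rewrite affine_shear//.
case: i => i; elim/ltn_ind: i => i IH iN xy.
have := xy (Ordinal iN) (ltnSn i); rewrite !tnth_mktuple.
have -> : \sum_(j < N | (j < i)%N) L (Ordinal iN) j * tnth x j =
    \sum_(j < N | (j < i)%N) L (Ordinal iN) j * tnth y j.
  apply: eq_bigr => -[j jN] /= ji; congr (_ * _); apply: IH => // k kj.
  by apply: xy; rewrite (leq_trans kj)// ltnS ltnW.
by move=> /addIr /(mulfI (L0 _)).
Qed.

Lemma measurable_whiten a L : measurable_fun setT (whiten a L).
Proof. exact: measurable_affine. Qed.

End whitening.

(** * Consequences of causality, and a criterion for it *)

Section causality.
Context d (T : measurableType d) (R : realType) (N : nat) (P : probability T R).
Variables X Y : T -> euclid R N.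
Hypotheses (mX : measurable_fun setT X) (mY : measurable_fun setT Y).

Lemma sub_sigma_algebra_prefix t (tN : (t <= N)%N) :
  g_sigma_algebra_preimage (tprefix tN \o X) `<=` g_sigma_algebra_preimage X.
Proof.
move=> _ [B mB <-]; exists (tprefix tN @^-1` B) => //.
by rewrite -[X in measurable X]setTI; exact: measurable_tprefix.
Qed.

Lemma measurable_sigma_algebra d' (T' : measurableType d') (Z : T -> T') B :
  measurable_fun setT Z -> g_sigma_algebra_preimage Z B -> measurable B.
Proof. by move=> mZ [C mC <-]; exact: mZ. Qed.

(* X = a + L G with G standard, and G_s is independent of X_{1:t} for t < s;
   causality transfers this independence to Y_{1:t}. *)
Lemma causal_indep (a : 'cV[R]_N) (L : 'M[R]_N) t (tN : (t <= N)%N) (s : 'I_N)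
    (E : set (euclid R t)) (D : set (measurableTypeR R)) :
  is_trig_mx L -> (forall i, L i i != 0) ->
  (forall F, measurable F -> P (X @^-1` F) = stdg R N (affine a L @^-1` F)) ->
  causal P X Y -> (0 < t)%N -> (t <= s)%N -> measurable E -> measurable D ->
  (P ((tprefix tN \o Y) @^-1` E `&` [set w | D (tnth (whiten a L (X w)) s)]) =
   P ((tprefix tN \o Y) @^-1` E) * normal_prob 0 1 D)%E.
Proof.
move=> Ltrig L0 PX XY t0 ts mE mD; have uL := unitmx_trig Ltrig L0.
pose Gs (x : euclid R N) : measurableTypeR R := tnth (whiten a L x) s.
have mGs : measurable_fun setT Gs.
  by apply: (measurableT_comp (measurable_tnth s)); exact: measurable_whiten.
have mGD : measurable (Gs @^-1` D) by rewrite -[X in measurable X]setTI; exact: mGs.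
set A := _ @^-1` E; set B := [set w | _].
have GB : g_sigma_algebra_preimage X B by exists (Gs @^-1` D) => //; rewrite setTI.
have mB : measurable B by exact: measurable_sigma_algebra GB.
have [g [h [[gi _ gE] [hi Gh hE] gh]]] := XY t tN t0 E mE.
have mh : measurable_fun setT h by case/integrableP : hi.
have mg : measurable_fun setT g by case/integrableP : gi.
have GT : g_sigma_algebra_preimage (tprefix tN \o X) setT.
  by exists setT => //; rewrite setTI.
(* [B] is an event of [X], so [g] may be integrated over it; causality then replaces [g] by [h],
   which is a function of [X_{1:t}] and hence independent of [B]. *)
rewrite -gE// (@ae_eq_integral _ _ _ P B h g)//; first last.
- by apply: filterS gh => w /= + _.
- exact: measurable_funTS.
- exact: measurable_funTS.
have c0 : 0 <= fine (normal_prob 0 1 D : \bar R) by rewrite fine_ge0.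
have cE : ((NngNum c0)%:num%:E = normal_prob 0 1 D :> \bar R)%E.
  by rewrite /= fineK// fin_num_measure.
rewrite (@integral_indep _ _ _ P B (NngNum c0))//; last first.
  move=> U mU; rewrite cE.
  have [C mC <-] := Gh U mU; rewrite setTI.
  have mXC : measurable (tprefix tN @^-1` C).
    by rewrite -[X in measurable X]setTI; exact: measurable_tprefix.
  transitivity (stdg R N (affine a L @^-1` (tprefix tN @^-1` C `&` Gs @^-1` D))).
    by apply: PX; exact: measurableI.
  transitivity (normal_prob 0 1 D * stdg R N (affine a L @^-1` (tprefix tN @^-1` C)))%E;
    last by congr (_ * _)%E; apply/esym; exact: PX.
  (* Read through [affine a L], an event of the first [t] coordinates of [X] involves only standard
     coordinates before [s], because [t <= s]. *)
  rewrite muleC preimage_setI -(stdg_indep (i := s) _ mD); first last.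
  - move=> x y xy /=; congr (C _); apply: eq_from_tnth => i.
    rewrite [LHS]tnth_mktuple [RHS]tnth_mktuple.
    apply: (@affine_depends_below _ _ a L (widen_ord tN i) Ltrig) => j ji; apply: xy.
    exact: leq_trans ji (leq_trans (ltn_ord i) ts).
  - by rewrite -[X in measurable X]setTI; apply: measurable_affine.
  congr (stdg _ _ (_ `&` _)); apply/seteqP; split => x /=; by rewrite /Gs affineK.
by rewrite cE muleC; congr (_ * _)%E; have := hE _ GT; rewrite setIT.
Qed.


(** When [Y] is an adapted function of [X], the indicator of the event, computed from [X_{1:t}], is
    a version of both conditional probabilities. The last hypothesis expresses [Y = Phi X] almost
    surely as: events that agree where this equation holds have the same probability. *)
Lemma causal_adapted (Phi : euclid R N -> euclid R N) :
  measurable_fun setT Phi ->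
  (forall i : 'I_N, depends_below i.+1 (fun x => tnth (Phi x) i)) ->
  (forall S S', measurable S -> measurable S' ->
    (forall w, Y w = Phi (X w) -> S w <-> S' w) -> P S = P S') ->
  causal P X Y.
Proof.
move=> mPhi dPhi PY t tN t0 E mE.
pose A := (tprefix tN \o Y) @^-1` E.
(* The event about [Y_{1:t}], rewritten as a set of prefixes of [X]. *)
pose C := (tprefix tN \o Phi \o @textend R N t) @^-1` E.
pose A' := (tprefix tN \o X) @^-1` C.
have mtX : measurable_fun setT (tprefix tN \o X).
  exact: (measurableT_comp (measurable_tprefix tN)).
have mA : measurable A.
  rewrite -[X in measurable X]setTI.
  by apply: (measurableT_comp (measurable_tprefix tN) mY) => //.
have mC : measurable C.
  rewrite -[X in measurable X]setTI.
  apply: (measurableT_comp (measurableT_comp (measurable_tprefix tN) mPhi)) => //.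
  exact: measurable_textend.
have mA' : measurable A' by rewrite -[X in measurable X]setTI; exact: mtX.
have tPhi x : tprefix tN (Phi x) = tprefix tN (Phi (textend N (tprefix tN x))).
  apply: eq_from_tnth => i; rewrite [LHS]tnth_mktuple [RHS]tnth_mktuple.
  apply/esym; apply: depends_below_tprefix (fun x => tnth (Phi x) _) _ _.
  by move=> y z yz; apply: dPhi => j ji; apply: yz; exact: leq_trans ji (ltn_ord i).
pose psi z : \bar R := (\1_C z)%:E.
have mpsi : measurable_fun setT psi.
  by apply/measurable_EFinP; exact: measurable_indic.
pose g := psi \o (tprefix tN \o X).
have gG G : (forall U, measurable U -> G (g @^-1` U)) ->
    (forall B, G B -> measurable B) -> is_cond_prob P G A g.
  move=> GU mG; split => //.
    exact: (integrable_indic P mA').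
  move=> B /mG mB; transitivity (\int[P]_(w in B) (\1_A' w)%:E)%E => //.
  rewrite integral_indic//.
  apply: PY; first exact: (measurableI _ _ mA' mB); first exact: (measurableI _ _ mA mB).
  by move=> w YX; rewrite /A /A' /C /= YX -tPhi.
have gU U : measurable U -> g_sigma_algebra_preimage (tprefix tN \o X) (g @^-1` U).
  move=> mU; exists (psi @^-1` U) => //; last by rewrite setTI.
  by rewrite -[X in measurable X]setTI; exact: mpsi.
exists g, g; split; last exact: aeW.
- apply: gG; first by move=> U /gU; exact: sub_sigma_algebra_prefix.
  by move=> B; exact: measurable_sigma_algebra.
- by apply: gG => // B; exact: measurable_sigma_algebra.
Qed.

End causality.

(** * The transport cost *)

Section gram.
Local Open Scope ereal_scope.
Context d (T : measurableType d) (R : realType) (P : probability T R).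

(** Bilinear expansion through the Gram matrix [K]. It serves both to compute the cost and, with a
    single square, to bound the correlations. *)
Lemma integral_sum_sqr (J I : finType) (c : J -> I -> R) (e : I -> T -> R)
    (K : I -> I -> R) :
  (forall i j, P.-integrable setT (fun x => (e i x * e j x)%:E)) ->
  (forall i j, \int[P]_x (e i x * e j x)%:E = (K i j)%:E) ->
  \int[P]_x (\sum_r (\sum_i c r i * e i x) ^+ 2)%:E =
  (\sum_r \sum_i \sum_j c r i * c r j * K i j)%:E.
Proof.
move=> ei eK.
have I1 r i j : P.-integrable setT (fun x => (c r i * c r j)%:E * (e i x * e j x)%:E).
  exact: integrableZl.
have I2 r i : P.-integrable setT
    (fun x => \sum_j (c r i * c r j)%:E * (e i x * e j x)%:E).
  by apply: integrable_sum => // j _; exact: I1.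
have I3 r : P.-integrable setT
    (fun x => \sum_i \sum_j (c r i * c r j)%:E * (e i x * e j x)%:E).
  by apply: integrable_sum => // i _; exact: I2.
transitivity (\int[P]_x
    (\sum_r \sum_i \sum_j (c r i * c r j)%:E * (e i x * e j x)%:E)).
  apply: eq_integral => x _; rewrite -sumEFin; apply: eq_bigr => r _.
  rewrite expr2 big_distrl/= -sumEFin; apply: eq_bigr => i _.
  rewrite big_distrr/= -sumEFin; apply: eq_bigr => j _.
  by rewrite -EFinM mulrACA.
rewrite integral_sum// -sumEFin; apply: eq_bigr => r _.
rewrite integral_sum// -sumEFin; apply: eq_bigr => i _.
rewrite integral_sum// -sumEFin; apply: eq_bigr => j _.
by rewrite integralZl// eK EFinM.
Qed.

End gram.

Section whitened.
Context d (T : measurableType d) (R : realType) (N : nat) (P : probability T R).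

Definition orthonormal_family (g : 'I_N -> T -> measurableTypeR R) :=
  (forall k, std_normal P (g k)) /\
  forall k l, k != l -> (\int[P]_x (g k x * g l x)%:E = 0)%E.

Lemma std_orthonormal (Z : T -> euclid R N) : measurable_fun setT Z ->
  (forall F, measurable F -> P (Z @^-1` F) = stdg R N F) ->
  orthonormal_family (fun k x => tnth (Z x) k).
Proof.
move=> mZ ZE.
have mt (D : set (measurableTypeR R)) k : measurable D ->
    measurable ((fun x : euclid R N => tnth x k) @^-1` D).
  by move=> mD; rewrite -[X in measurable X]setTI; exact: measurable_tnth.
have sg k : std_normal P (fun x => tnth (Z x) k).
  split; first by apply: (measurableT_comp (measurable_tnth k)).
  by move=> D mD; rewrite (stdg_marginal k mD) -ZE//; exact: mt.
(* [stdg_indep] separates a coordinate only from those before it, so the indices are ordered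
   first. *)
split => // k l; wlog : k l / (k < l)%N.
  move=> + kl; have /orP[kl'|lk'] : (k < l)%N || (l < k)%N by rewrite -neq_ltn.
    by apply.
  move=> /(_ l k lk'); rewrite eq_sym => /(_ kl) <-.
  by apply: eq_integral => x _; rewrite mulrC.
move=> kl _; apply: std_normal_indepM => // D E mD mE.
have [_ sk] := sg k; have [_ sl] := sg l.
rewrite -(sl E mE) -[X in _ = (X * _)%E]/(P (Z @^-1` ((fun x => tnth x k) @^-1` D))).
rewrite ZE; last exact: mt.
rewrite -(stdg_indep (i := l) _ mE)//; first last.
- by move=> x y xy /=; rewrite xy.
- exact: mt.
by rewrite -ZE//; apply: measurableI; exact: mt.
Qed.

Lemma whiten_law (X : T -> euclid R N) (a : 'cV[R]_N) (L : 'M[R]_N) :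
  measurable_fun setT X -> is_trig_mx L -> (forall i, L i i != 0) ->
  (forall F, measurable F -> P (X @^-1` F) = stdg R N (affine a L @^-1` F)) ->
  forall F, measurable F -> P ((whiten a L \o X) @^-1` F) = stdg R N F.
Proof.
move=> mX Ltrig L0 PX F mF; have uL := unitmx_trig Ltrig L0.
rewrite comp_preimage PX; last first.
  by rewrite -[X in measurable X]setTI; exact: measurable_whiten.
congr (stdg _ _ _); apply/seteqP.
by split => x /=; rewrite affineK.
Qed.

End whitened.

Section causal_orthogonal.
Context d (T : measurableType d) (R : realType) (N : nat) (P : probability T R).
Variables X Y : T -> euclid R N.
Hypotheses (mX : measurable_fun setT X) (mY : measurable_fun setT Y).
Variables (a b : 'cV[R]_N) (L M : 'M[R]_N).
Hypotheses (Ltrig : is_trig_mx L) (L0 : forall i, L i i != 0).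
Hypotheses (Mtrig : is_trig_mx M) (M0 : forall i, M i i != 0).
Hypothesis PX :
  forall F, measurable F -> P (X @^-1` F) = stdg R N (affine a L @^-1` F).
Hypothesis PY :
  forall F, measurable F -> P (Y @^-1` F) = stdg R N (affine b M @^-1` F).

Lemma causal_orthogonal (s t : 'I_N) : causal P X Y -> (t < s)%N ->
  (\int[P]_x (tnth (whiten a L (X x)) s * tnth (whiten b M (Y x)) t)%:E = 0)%E.
Proof.
move=> XY ts.
have mw c K (Z : T -> euclid R N) : measurable_fun setT Z ->
    measurable_fun setT (whiten c K \o Z).
  by move=> mZ; apply: measurableT_comp => //; exact: measurable_whiten.
have [sX _] := std_orthonormal (mw a L X mX) (whiten_law mX Ltrig L0 PX).
have [sY _] := std_orthonormal (mw b M Y mY) (whiten_law mY Mtrig M0 PY).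
apply: (std_normal_indepM (sX s) (sY t)) => D E mD mE.
have [_ sXs] := sX s; rewrite -(sXs D mD) setIC muleC.
have tN := ltn_ord t.
(* Indices start at [0], so whitened coordinate [t] of [Y] needs a prefix of length [t.+1]; the
   hypothesis [t < s] is exactly the bound on that length in [causal_indep]. *)
pose F := (fun z : euclid R t.+1 => tnth (whiten b M (textend N z)) t) @^-1` E.
have mF : measurable F.
  rewrite -[X in measurable X]setTI.
  apply: (measurableT_comp (measurable_tnth t)) => //.
  by apply: measurableT_comp; [exact: measurable_whiten|exact: measurable_textend].
have -> : (fun x => tnth ((whiten b M \o Y) x) t) @^-1` E = (tprefix tN \o Y) @^-1` F.
  apply/seteqP; split => w; rewrite /F /=;
  by rewrite (depends_below_tprefix tN (Y w) (whiten_depends_below b Mtrig M0)).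
exact: (causal_indep mX tN Ltrig L0 PX XY).
Qed.

End causal_orthogonal.

Section cost.
Context d (T : measurableType d) (R : realType) (N : nat) (P : probability T R).
Variables (g h : 'I_N -> T -> measurableTypeR R).
Hypotheses (og : orthonormal_family P g) (oh : orthonormal_family P h).
Hypothesis gh : forall k l, k != l -> (\int[P]_x (g k x * h l x)%:E = 0)%E.

Definition correlation k : R := fine (\int[P]_x (g k x * h k x)%:E)%E.

(** Gram matrix of the constant [1], the [g k] and the [h k]. The constant belongs to the family in
    order to carry the shift [c] of [integral_cost]. *)
Let gramK (i j : 'I_1 + ('I_N + 'I_N)) : R := match i, j with
  | inl _, inl _ => 1
  | inr (inl k), inr (inl l) => (k == l)%:R
  | inr (inr k), inr (inr l) => (k == l)%:R
  | inr (inl k), inr (inr l) => (k == l)%:R * correlation k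
  | inr (inr k), inr (inl l) => (k == l)%:R * correlation k
  | _, _ => 0
  end.

Let e (i : 'I_1 + ('I_N + 'I_N)) : T -> R := match i with
  | inl _ => fun=> 1
  | inr (inl k) => g k
  | inr (inr k) => h k
  end.

Let ghE k l : (\int[P]_x (g k x * h l x)%:E = ((k == l)%:R * correlation k)%:E)%E.
Proof.
have [<-|kl] := eqVneq k l; last by rewrite gh// mul0r.
rewrite mul1r /correlation fineK//; apply: integrable_fin_num => //.
by apply: std_normal_integrableM; [case: og|case: oh].
Qed.

Let orthoE (f : 'I_N -> T -> measurableTypeR R) k l : orthonormal_family P f ->
  (\int[P]_x (f k x * f l x)%:E = (k == l)%:R%:E)%E.
Proof.
move=> [sf of_]; have [<-|kl] := eqVneq k l; last by rewrite of_.
have [_ <-] := std_normal_sqr (sf k).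
by apply: eq_integral => x _; rewrite expr2.
Qed.

Let e_integrable i j : P.-integrable setT (fun x => (e i x * e j x)%:E).
Proof.
have [[sg _] [sh _]] := (og, oh).
have ig f : std_normal P f -> P.-integrable setT (fun x => (f x)%:E).
  by move=> /std_normal_id[].
case: i => [?|[k|k]]; case: j => [?|[l|l]] /=.
- by under eq_fun do rewrite mulr1; exact: finite_measure_integrable_cst.
- by under eq_fun do rewrite mul1r; exact: ig.
- by under eq_fun do rewrite mul1r; exact: ig.
- by under eq_fun do rewrite mulr1; exact: ig.
- exact: std_normal_integrableM.
- exact: std_normal_integrableM.
- by under eq_fun do rewrite mulr1; exact: ig.
- exact: std_normal_integrableM.
- exact: std_normal_integrableM.
Qed.

Let eE i j : (\int[P]_x (e i x * e j x)%:E = (gramK i j)%:E)%E.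
Proof.
have [[sg _] [sh _]] := (og, oh).
have ig f : std_normal P f -> (\int[P]_x (f x)%:E = 0)%E.
  by move=> /std_normal_id[].
case: i => [?|[k|k]]; case: j => [?|[l|l]] /=.
- by under eq_integral do rewrite mulr1; rewrite integral_cst//= probability_setT mule1.
- by under eq_integral do rewrite mul1r; exact: ig.
- by under eq_integral do rewrite mul1r; exact: ig.
- by under eq_integral do rewrite mulr1; exact: ig.
- exact: orthoE.
- exact: ghE.
- by under eq_integral do rewrite mulr1; exact: ig.
- under eq_integral do rewrite mulrC.
  by rewrite ghE eq_sym; case: eqVneq => [->|]//; rewrite !mul0r.
- exact: orthoE.
Qed.

Let sum_kron (f : 'I_N -> 'I_N -> R) (k : 'I_N) :
  \sum_l f k l * (k == l)%:R = f k k.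
Proof.
rewrite (bigD1 k)//= eqxx mulr1 big1 ?addr0// => l lk.
by rewrite eq_sym (negbTE lk) mulr0.
Qed.

(** Of the cross terms only those with equal indices survive in [gramK]; exchanging the sums over
    rows and columns gathers [L i k * M i k] into the diagonal of [L^T *m M]. *)
Lemma integral_cost (c : 'I_N -> R) (L M : 'M[R]_N) :
  (\int[P]_x (\sum_i (c i + \sum_k L i k * g k x - \sum_k M i k * h k x) ^+ 2)%:E =
   (\sum_i c i ^+ 2 + \sum_i \sum_k L i k ^+ 2 + \sum_i \sum_k M i k ^+ 2 -
    2 * \sum_k (L^T *m M) k k * correlation k)%:E)%E.
Proof.
pose cc (i : 'I_N) (j : 'I_1 + ('I_N + 'I_N)) : R := match j with
  | inl _ => c i | inr (inl k) => L i k | inr (inr k) => - M i k end.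
have := integral_sum_sqr cc e_integrable eE.
rewrite [in X in X = _ -> _](eq_integral (fun x => (\sum_i (c i + \sum_k L i k * g k x
  - \sum_k M i k * h k x) ^+ 2)%:E)); last first.
  move=> x _; congr EFin; apply: eq_bigr => i _; congr (_ ^+ 2).
  rewrite !big_sumType/= big_ord1 mulr1 -sumrN addrA; congr (_ + _).
  by apply: eq_bigr => k _; rewrite mulNr.
move=> ->; congr EFin.
have -> : \sum_k (L^T *m M) k k * correlation k =
    \sum_i \sum_k L i k * M i k * correlation k.
  rewrite exchange_big/=; apply: eq_bigr => k _.
  by rewrite !mxE mulr_suml; apply: eq_bigr => i _; rewrite !mxE.
rewrite mulr_sumr -!big_split/= -sumrB; apply: eq_bigr => i _.
have kron (f : 'I_N -> R) k (r : R) :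
    \sum_l f l * ((k == l)%:R * r) = f k * r.
  by rewrite -(sum_kron (fun k l => f l * r) k); apply: eq_bigr => l _; ring.
have kron1 (f : 'I_N -> R) k : \sum_l f l * (k == l)%:R = f k.
  by rewrite -(sum_kron (fun k l => f l) k).
rewrite !big_sumType/= !big_ord1.
have -> : \sum_j c i * cc i j * gramK (inl ord0) j = c i ^+ 2.
  rewrite !big_sumType/= big_ord1 mulr1 !big1 ?addr0 ?expr2// => k _;
  by rewrite mulr0.
rewrite -addrA -addrA; congr (_ + _).
under eq_bigr => k _.
  rewrite !big_sumType/= big_ord1 mulr0 add0r kron1 kron; over.
under [X in _ + X = _]eq_bigr => k _.
  rewrite !big_sumType/= big_ord1 mulr0 add0r kron1 kron; over.
rewrite -!big_split mulr_sumr -sumrB/=; apply: eq_bigr => k _.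
by ring.
Qed.

(** The second moment of [g k + s * h k] is [2 + 2 * s * correlation k] when [s ^+ 2 = 1], and it is
    nonnegative for both signs of [s]. *)
Lemma correlation_le1 k : `|correlation k| <= 1.
Proof.
have key (s : R) : s ^+ 2 = 1 -> 0 <= 1 + s * correlation k.
  move=> s2.
  pose f (b : bool) := if b then g k else h k.
  pose K (b b' : bool) := if b == b' then 1 else correlation k.
  have [[sg _] [sh _]] := (og, oh).
  have fi b b' : P.-integrable setT (fun x => (f b x * f b' x)%:E).
    by apply: std_normal_integrableM; [case: b|case: b'] => /=.
  have fE b b' : (\int[P]_x (f b x * f b' x)%:E = (K b b')%:E)%E.
    case: b; case: b' => /=; rewrite /f /K/=.
    - by rewrite orthoE// eqxx.
    - by rewrite ghE eqxx mul1r.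
    - by under eq_integral do rewrite mulrC; rewrite ghE eqxx mul1r.
    - by rewrite orthoE// eqxx.
  have := @integral_sum_sqr _ _ _ P 'I_1 bool (fun _ b => if b then 1 else s) f K fi fE.
  set lhs := (X in X = _ -> _) => lhsE.
  have : (0 <= lhs)%E.
    by apply: integral_ge0 => x _; rewrite lee_fin sumr_ge0// => ? _; exact: sqr_ge0.
  rewrite lhsE lee_fin big_ord1 !big_bool/= /K/=.
  by move: s2; rewrite expr2 => s2; lra.
rewrite ler_norml; have := key 1 (expr1n _ _); have := key (-1) (sqrr_sign R 1).
by move=> ? ?; apply/andP; split; lra.
Qed.

End cost.

(** * The synchronous coupling and the lower bound *)

Section optimal_coupling.
Context (R : realType) (N : nat).

Lemma enorm_sqr (v : 'cV[R]_N) : enorm v ^+ 2 = \sum_i v i ord0 ^+ 2.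
Proof. by rewrite sqr_sqrtr// sumr_ge0// => i _; exact: sqr_ge0. Qed.

Lemma mxtrace_mul_tr (L : 'M[R]_N) : \tr (L *m L^T) = \sum_i \sum_k L i k ^+ 2.
Proof.
apply: eq_bigr => i _; rewrite mxE; apply: eq_bigr => k _.
by rewrite mxE expr2.
Qed.

Lemma enorm_sqr_affine (a b : 'cV[R]_N) (L M : 'M[R]_N) (x y : euclid R N) :
  enorm (vec (affine a L x) - vec (affine b M y)) ^+ 2 =
  \sum_i ((a - b) i ord0 + \sum_k L i k * tnth x k - \sum_k M i k * tnth y k) ^+ 2.
Proof.
rewrite enorm_sqr; apply: eq_bigr => i _; congr (_ ^+ 2).
by rewrite !mxE !tnth_mktuple; ring.
Qed.

Lemma adapted_affine_whiten (a b : 'cV[R]_N) (L M : 'M[R]_N) (i : 'I_N) :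
  is_trig_mx L -> (forall i, L i i != 0) -> is_trig_mx M ->
  depends_below i.+1 (fun x => tnth (affine b M (whiten a L x)) i).
Proof.
move=> Ltrig L0 Mtrig x y xy.
apply: (@affine_depends_below _ _ b M i Mtrig) => j ji.
apply: (@whiten_depends_below _ _ a L j Ltrig L0) => k kj.
by apply: xy; exact: leq_trans kj ji.
Qed.

Lemma measurable_enorm_sqr :
  measurable_fun setT (fun z : euclid R N * euclid R N =>
    (enorm (vec z.1 - vec z.2) ^+ 2)%:E).
Proof.
apply/measurable_EFinP; under eq_fun do rewrite enorm_sqr.
apply: measurable_sum => i; apply: measurable_funX.
under eq_fun do rewrite !mxE.
apply: measurable_funB.
  exact: (measurableT_comp (measurable_tnth i) measurable_fst).
exact: (measurableT_comp (measurable_tnth i) measurable_snd).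
Qed.

Definition affine_pair (a b : 'cV[R]_N) (L M : 'M[R]_N) (x : euclid R N) :
  euclid R N * euclid R N := (affine a L x, affine b M x).

Lemma measurable_affine_pair a b L M : measurable_fun setT (affine_pair a b L M).
Proof. by apply: measurable_fun_pair; exact: measurable_affine. Qed.

(* Both Gaussian vectors are driven by the same standard Gaussian vector. *)
Definition synchronous a b L M : probability (euclid R N * euclid R N)%type R :=
  push_prob (stdg R N) (measurable_affine_pair a b L M).

(** Whitening one marginal recovers the driving vector, and both steps are adapted. On the image of
    [affine_pair] the resulting equation is exact, so events that agree there have the same
    preimage. *)
Lemma synchronous_bicausal (mu nu : probability (euclid R N) R) a b L M :
  is_trig_mx L -> (forall i, L i i != 0) -> is_trig_mx M -> (forall i, M i i != 0) ->
  is_gaussian mu a (L *m L^T) -> is_gaussian nu b (M *m M^T) ->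
  bicausal_coupling mu nu (synchronous a b L M).
Proof.
move=> Ltrig L0 Mtrig M0 hmu hnu.
have [uL uM] := (unitmx_trig Ltrig L0, unitmx_trig Mtrig M0).
have mAW c c' (K K' : 'M[R]_N) : measurable_fun setT (affine c K \o whiten c' K').
  by apply: measurableT_comp; [exact: measurable_affine|exact: measurable_whiten].
split.
- by move=> E mE; rewrite (gaussian_image Ltrig L0 hmu)// (gaussian_image Mtrig M0 hnu).
- apply: (causal_adapted measurable_fst measurable_snd (mAW b a M L)).
    by move=> i; exact: adapted_affine_whiten.
  move=> S S' mS mS' SS'; congr (stdg R N _); apply/seteqP.
  by split => x /=; apply SS'; rewrite /= affineK.
- apply: (causal_adapted measurable_snd measurable_fst (mAW a b L M)).
    by move=> i; exact: adapted_affine_whiten.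
  move=> S S' mS mS' SS'; congr (stdg R N _); apply/seteqP.
  by split => x /=; apply SS'; rewrite /= affineK.
Qed.

(** The two whitened families coincide, so every correlation is the second moment [1]. *)
Lemma synchronous_cost (a b : 'cV[R]_N) (L M : 'M[R]_N) :
  (\int[synchronous a b L M]_z (enorm (vec z.1 - vec z.2) ^+ 2)%:E =
   (enorm (a - b) ^+ 2 + \tr (L *m L^T) + \tr (M *m M^T) -
    2 * \sum_k (L^T *m M) k k)%:E)%E.
Proof.
have o := @std_orthonormal _ _ _ _ (stdg R N) id (@measurable_id _ _ _) (fun _ _ => erefl).
rewrite (@ge0_integral_image _ _ _ _ _ (affine_pair a b L M) (stdg R N))//; last first.
- by move=> z; rewrite lee_fin sqr_ge0.
- exact: measurable_enorm_sqr.
- exact: measurable_affine_pair.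
under eq_integral do rewrite enorm_sqr_affine.
rewrite (integral_cost o o o.2) enorm_sqr !mxtrace_mul_tr.
congr (_ - _ * _)%:E; apply: eq_bigr => k _.
rewrite /correlation; under eq_integral do rewrite -expr2.
by have [_ ->] := std_normal_sqr (o.1 k); rewrite mulr1.
Qed.

Lemma bicausal_cost_ge (mu nu : probability (euclid R N) R)
    (gamma : probability (euclid R N * euclid R N)%type R) a b L M :
  is_trig_mx L -> (forall i, L i i != 0) -> is_trig_mx M -> (forall i, M i i != 0) ->
  is_gaussian mu a (L *m L^T) -> is_gaussian nu b (M *m M^T) ->
  bicausal_coupling mu nu gamma ->
  ((enorm (a - b) ^+ 2 + dABW_sq (L *m L^T) (M *m M^T) L M)%:E <=
   \int[gamma]_z (enorm (vec z.1 - vec z.2) ^+ 2)%:E)%E.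
Proof.
move=> Ltrig L0 Mtrig M0 hmu hnu [cpl c12 c21].
have [uL uM] := (unitmx_trig Ltrig L0, unitmx_trig Mtrig M0).
have m1 := @measurable_fst _ _ (euclid R N) (euclid R N).
have m2 := @measurable_snd _ _ (euclid R N) (euclid R N).
have PX F : measurable F -> gamma (fst @^-1` F) = stdg R N (affine a L @^-1` F).
  by move=> mF; rewrite (cpl F mF).1; exact: gaussian_image.
have PY F : measurable F -> gamma (snd @^-1` F) = stdg R N (affine b M @^-1` F).
  by move=> mF; rewrite (cpl F mF).2; exact: gaussian_image.
have mw c K (Z : euclid R N * euclid R N -> euclid R N) :
    measurable_fun setT Z -> measurable_fun setT (whiten c K \o Z).
  by move=> mZ; apply: measurableT_comp => //; exact: measurable_whiten.
have og := std_orthonormal (mw a L _ m1) (whiten_law m1 Ltrig L0 PX).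
have oh := std_orthonormal (mw b M _ m2) (whiten_law m2 Mtrig M0 PY).
set g := fun k x => _ in og; set h := fun k x => _ in oh.
have gh k l : k != l -> (\int[gamma]_x (g k x * h l x)%:E = 0)%E.
  (* Each direction of causality annihilates one triangle of the cross-covariance matrix. *)
  rewrite -val_eqE neq_ltn => /orP[kl|lk].
    under eq_integral do rewrite mulrC.
    exact: (causal_orthogonal m2 m1 Mtrig M0 Ltrig L0 PY PX c21 kl).
  exact: (causal_orthogonal m1 m2 Ltrig L0 Mtrig M0 PX PY c12 lk).
under eq_integral => z _.
  rewrite -{1}(whitenK a uL z.1) -{1}(whitenK b uM z.2) enorm_sqr_affine; over.
rewrite (integral_cost og oh gh) lee_fin -enorm_sqr -!mxtrace_mul_tr /dABW_sq.
suff : \sum_k (L^T *m M) k k * correlation gamma g h k <=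
    l1norm (diag_vec (L^T *m M)) by move=> ?; lra.
apply: ler_sum => k _; rewrite [in leRHS]mxE.
apply: le_trans (ler_norm _) _; rewrite normrM.
by rewrite ler_piMr//; exact: correlation_le1.
Qed.

End optimal_coupling.

Theorem theorem1p1 (R : realType) (N : nat) (hN : (1 <= N)%N)
    (a b : 'cV[R]_N) (A B L M : 'M[R]_N)
    (mu nu : probability (euclid R N) R)
    (hA : sym_posdef A) (hB : sym_posdef B)
    (hmu : is_gaussian mu a A) (hnu : is_gaussian nu b B)
    (hL : is_cholesky A L) (hM : is_cholesky B M) :
  (AW2 mu nu ^+ 2)%E = (enorm (a - b) ^+ 2 + dABW_sq A B L M)%:E.
Proof.
case: hL hM => Ltrig Lpos AE [Mtrig Mpos BE]; subst A B.
have L0 i : L i i != 0 by rewrite gt_eqF.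
have M0 i : M i i != 0 by rewrite gt_eqF.
(* Squaring undoes [sqrte] because the infimum of nonnegative costs is nonnegative. *)
rewrite /AW2 sqr_sqrte; last first.
  apply: le_ereal_inf_tmp => _ [gamma _ <-].
  by apply: integral_ge0 => z _; rewrite lee_fin sqr_ge0.
apply/eqP; rewrite eq_le; apply/andP; split; last first.
  apply: le_ereal_inf_tmp => _ [gamma hgamma <-].
  exact: bicausal_cost_ge hgamma.
(* The sign takes the value [1] at [0], so that [eps k ^+ 2 = 1] always holds and the diagonal of
   [M'] cannot vanish. *)
pose eps k : R := if 0 <= (L^T *m M) k k then 1 else -1.
have eps2 k : eps k ^+ 2 = 1 by rewrite /eps; case: ifP => _; rewrite ?sqrrN expr1n.
(* Flipping columns of [M] leaves the covariance of [nu] unchanged, while the diagonal of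
   [L^T *m M'] becomes the absolute value of that of [L^T *m M]. *)
pose M' : 'M[R]_N := \matrix_(i, k) (M i k * eps k).
have M'E : M' *m M'^T = M *m M^T.
  apply/matrixP => i j; rewrite !mxE; apply: eq_bigr => k _.
  by rewrite !mxE mulrACA -expr2 eps2 mulr1.
have M'trig : is_trig_mx M'.
  by apply/is_trig_mxP => i j ij; rewrite mxE (is_trig_mxP Mtrig) ?mul0r.
have M'0 i : M' i i != 0.
  by rewrite mxE mulf_neq0// -sqrf_eq0 eps2 oner_neq0.
have hnu' : is_gaussian nu b (M' *m M'^T) by rewrite M'E.
have bc := synchronous_bicausal Ltrig L0 M'trig M'0 hmu hnu'.
apply: ereal_inf_lbound; exists (synchronous a b L M') => //.
rewrite synchronous_cost M'E /dABW_sq; congr EFin; rewrite !addrA.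
congr (_ - _ * _); apply: eq_bigr => k _; rewrite [in RHS]mxE.
transitivity ((L^T *m M) k k * eps k).
  by rewrite !mxE mulr_suml; apply: eq_bigr => i _; rewrite !mxE mulrA.
rewrite /eps; case: ifPn => [/ger0_norm ->|]; first by rewrite mulr1.
by rewrite -ltNge => /ltr0_norm ->; rewrite mulrN1.
Qed.
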